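(* Let $\mathbf{k}$ be a field of characteristic zero and let $(A, D_0, D_1, D_2,\dots)$ be a (commutative) $\mathrm{BV}_\infty$ algebra over $\mathbf{k}$ which has the degeneration property. Then the associated $L_\infty$ algebra $\mathfrak{g}=\Pi A$, whose structure maps on $\Pi\mathfrak{g}=A$ are $m_n(a_1,\dots,a_n)=[[\dots[[D_{n-1},a_1],a_2],\dots],a_n](1)$ for $n\ge 1$, is homotopy abelian.
   Context: Conventions. All vector spaces are super ($\mathbb{Z}/2\mathbb{Z}$-graded) over a field $\mathbf{k}$ of characteristic zero, with the Koszul sign rule; commutativity, commutators, derivations etc. are understood in the graded sense, and commutative algebras are associative. $\Pi$ denotes parity reversion (so $\Pi\Pi A=A$). For an algebra $A$, $\operatorname{End}(A)$ is the associative superalgebra of all linear operators on $A$ (even and odd); an element $a\in A$ is regarded as the operator of multiplication $x\mapsto ax$, and $[\,\cdot,\cdot\,]$ is the graded commutator in $\operatorname{End}(A)$. Differential operators. For a unital commutative algebra $A$, put $F_{-1}=\{0\}$ and recursively $F_n=\{D\in\operatorname{End}(A): [D,a]\in F_{n-1}\text{ for all }a\in A\}$. An $n$-th order differential operator means an element of $F_n$ (order not higher than $n$). $\mathrm{BV}_\infty$ algebras. A (commutative) $\mathrm{BV}_\infty$ algebra is a unital commutative algebra $A$ with odd linear operators $D_0,D_1,D_2,\dots$ such that (i) $D=D_0+hD_1+h^2D_2+\dots\in\operatorname{End}(A)[[h]]$ ($h$ an even formal variable) satisfies $D^2=0$ and $D(1)=0$; (ii) each $D_i$ is an $(i+1)$-th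 order differential operator. It has the degeneration property if for every $N\geq 1$ the homology of $A[h]/(h^N)$ with respect to the differential induced by $D$ is a free $\mathbf{k}[h]/(h^N)$-module. $L_\infty$ algebras. A complete vector space is an inverse limit of finite-dimensional ones (e.g. the dual $V^*$ of a discrete vector space $V$), maps between complete spaces are continuous, and tensor products of complete spaces are completed. $\widehat{S}W$ is the completed symmetric algebra on a complete space $W$. A (continuous) derivation of $\widehat{S}\Pi V^*$ has order $n$ if it maps $\Pi V^*$ into the symmetric degree $n$ part. An $L_\infty$ structure on $V$ is an odd derivation $m=m_1^*+m_2^*+\dots$ of $\widehat{S}\Pi V^*$, with $m_n^*$ of order $n\ge 1$, such that $m\circ m=0$. Composing $m_n^*\colon \Pi V^*\to ((\Pi V^* )^{\otimes n})_{S_n}$ with the identification of $S_n$-coinvariants with $S_n$-invariants $x_1\otimes\dots\otimes x_n\mapsto\sum_{\sigma\in S_n}\sigma[x_1\otimes\dots\otimes x_n]$ and dualising, this is equivalent to a collection of odd symmetric multilinear maps $m_n\colon(\Pi V)^{\otimes n}\to\Pi V$, $n\geq1$, subject to the identities expressing $m\circ m=0$; in particular $m_1$ is a differential. An $L_\infty$ map $(V,m_V)\to(W,m_W)$ is a continuous morphism of commutative algebras $f\colon\widehat{S}\Pi W^*\to\widehat{S}\Pi V^*$ (equivalently a collection of even symmetric maps $f_n\colon(\Pi V)^{\otimes n}\to\Pi W$, $n\ge1$) with $f\circ m_W=m_V\circ f$; it is an $L_\infty$ quasi-isomorphism if $f_1\colon\Pi V\to\Pi W$ is a quasi-isomorphism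 with respect to the linear components of $m_V,m_W$. An $L_\infty$ algebra is abelian if $m_n=0$ for all $n\ge2$, and homotopy abelian if it is $L_\infty$ quasi-isomorphic to an abelian one. It is a fact that for any $\mathrm{BV}_\infty$ algebra $A$ the maps $m_n$ in the claim define an $L_\infty$ structure on $\Pi A$; its differential is $m_1=D_0$. It is the reduction at $h=0$ of the $L_\infty$ structure on $\Pi A[[h]]$ with operations $h^{-(n-1)}[[\dots[D,a_1],\dots],a_n](1)$. *)

(* Defs.v *)
From HB Require Import structures.
From mathcomp Require Export all_boot all_order all_algebra.
From mathcomp Require Export finmap.

Set Implicit Arguments.
Unset Strict Implicit.
Unset Printing Implicit Defensive.

Import GRing.Theory.
Local Open Scope ring_scope.

(* A Z/2-graded vector space: [spr b] is the projection onto the summand of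
   parity [b] ([false] is even, [true] is odd). *)
Record superspace (k : fieldType) := Superspace {
  scar :> lmodType k;
  spr : bool -> {linear scar -> scar};
  spr_spr : forall b c x, spr b (spr c x) = if b == c then spr c x else 0;
  spr_sum : forall x, spr false x + spr true x = x
}.

Definition homog (k : fieldType) (V : superspace k) (b : bool) (x : V) : Prop :=
  spr V b x = x.

Section ParityReversion.
Variables (k : fieldType) (V : superspace k).

Let pr (b : bool) : {linear V -> V} := spr V (~~ b).

Lemma Pi_spr_spr b c x : pr b (pr c x) = if b == c then pr c x else 0.
Proof. by rewrite /pr spr_spr (inj_eq negb_inj). Qed.

Lemma Pi_spr_sum x : pr false x + pr true x = x.
Proof. by rewrite /pr addrC spr_sum. Qed.

Definition Pi : superspace k := Superspace Pi_spr_spr Pi_spr_sum.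

End ParityReversion.

(* [End(V)] consists of the linear maps [V -> V]; the operators below are bare
   functions, and every construction preserves linearity. *)
Section Operators.
Variables (k : fieldType) (V : superspace k).
Implicit Types P Q : V -> V.

Definition hpart (b : bool) P : V -> V :=
  fun x => \sum_(c : bool) spr V (b (+) c) (P (spr V c x)).

Definition scomm P Q : V -> V :=
  fun x => \sum_(b : bool) \sum_(c : bool)
    (hpart b P (hpart c Q x) - (-1) ^+ (b && c) *: hpart c Q (hpart b P x)).

End Operators.

(* The structure is not built on [algType], which would exclude the zero
   algebra. *)
Record scomalg (k : fieldType) := Scomalg {
  sacar :> superspace k;
  smul : sacar -> sacar -> sacar;
  sone : sacar;
  smul_linl : forall (c : k) x y z,
    smul (c *: x + y) z = c *: smul x z + smul y z;
  smul_linr : forall (c : k) x y z,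
    smul z (c *: x + y) = c *: smul z x + smul z y;
  smulA : forall x y z, smul x (smul y z) = smul (smul x y) z;
  smul1x : forall x, smul sone x = x;
  smulx1 : forall x, smul x sone = x;
  smul_homog : forall b c x y,
    homog b x -> homog c y -> homog (b (+) c) (smul x y);
  smulC : forall b c x y,
    homog b x -> homog c y -> smul x y = (-1) ^+ (b && c) *: smul y x
}.
Arguments sone {k} s.

(* [in_Fpred n] is F_{n-1}: the filtration starts with F_{-1} = 0. *)
Fixpoint in_Fpred (k : fieldType) (A : scomalg k) (n : nat) (P : A -> A) : Prop :=
  match n with
  | 0 => forall x, P x = 0
  | n'.+1 => forall a : A, in_Fpred n' (scomm P (smul a))
  end.

Definition diffop (k : fieldType) (A : scomalg k) (n : nat) (P : A -> A) : Prop :=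
  in_Fpred n.+1 P.

Record BVinfty (k : fieldType) := BVInfty {
  bvalg :> scomalg k;
  bvD : nat -> {linear bvalg -> bvalg};
  bvD_odd : forall i b x, homog b x -> homog (~~ b) (bvD i x);
  bvD_sq : forall n x, \sum_(i < n.+1) bvD i (bvD (n - i)%N x) = 0;
  bvD_one : forall i, bvD i (sone bvalg) = 0;
  bvD_order : forall i, diffop i.+1 (bvD i)
}.

Section Degeneration.
Variables (k : fieldType) (A : BVinfty k).

(* A[h]/(h^N): [a i] is the coefficient of h^i. *)
Definition trunc (N : nat) := {ffun 'I_N -> A}.

Definition hscale (N : nat) (c : {poly %/ 'X^N : {poly k}}) (a : trunc N)
    : trunc N :=
  [ffun i : 'I_N => \sum_(j < N) \sum_(l < N | (j + l == i)%N)
    (c : {poly k})`_j *: a l].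

Definition hD (N : nat) (a : trunc N) : trunc N :=
  [ffun i : 'I_N => \sum_(j < N) \sum_(l < N | (j + l == i)%N) bvD A j (a l)].

(* The classes of the cycles [e i] form a basis of the homology: every
   cycle is, modulo boundaries, a unique finite k[h]/(h^N)-linear combination
   of them. *)
Definition homology_free (N : nat) : Prop :=
  exists (I : choiceType) (e : I -> trunc N),
    (forall i, hD (e i) = 0) /\
    forall z : trunc N, hD z = 0 ->
      exists! c : {fsfun I -> {poly %/ 'X^N : {poly k}} with 0},
        exists a : trunc N,
          z - \sum_(i <- finsupp c) hscale (c i) (e i) = hD a.

Definition degeneration : Prop := forall N : nat, (1 <= N)%N -> homology_free N.

End Degeneration.

(* A collection of maps U^n -> W, n >= 0, is encoded as one function on finite
   sequences: its n-th member is the restriction to sequences of length n. *)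
Section Multimaps.
Variables (k : fieldType) (U W : superspace k).
Implicit Type f : seq U -> W.

Definition multilinear f : Prop :=
  forall (s1 s2 : seq U) (c : k) (x y : U),
    f (s1 ++ (c *: x + y) :: s2) = c *: f (s1 ++ x :: s2) + f (s1 ++ y :: s2).

(* Adjacent transpositions generate the symmetric group. *)
Definition ssymmetric f : Prop :=
  forall (s1 s2 : seq U) (b c : bool) (x y : U), homog b x -> homog c y ->
    f (s1 ++ x :: y :: s2) = (-1) ^+ (b && c) *: f (s1 ++ y :: x :: s2).

Definition has_parity (b : bool) f : Prop :=
  forall (n : nat) (p : 'I_n -> bool) (x : 'I_n -> U),
    (forall i, homog (p i) (x i)) ->
    homog (b (+) \big[addb/false]_(i < n) p i) (f [seq x i | i : 'I_n]).

(* There are only operations with n >= 1 inputs. *)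
Definition multimap (b : bool) f : Prop :=
  [/\ multilinear f, ssymmetric f, has_parity b f & f [::] = 0].

End Multimaps.

(* The sign (-1)^e such that stably sorting elements x_0, ..., x_{n-1} of
   parities [p i] by increasing label [c i] gives
   x_0 ... x_{n-1} = (-1)^e x_{sorted} in a graded commutative algebra. *)
Definition koszul (k : fieldType) (n : nat) (p : 'I_n -> bool)
    (c : 'I_n -> nat) : k :=
  (-1) ^+ #|[set ij : 'I_n * 'I_n |
              [&& (ij.1 < ij.2)%N, (c ij.2 < c ij.1)%N, p ij.1 & p ij.2]]|.

Definition sub_args (T : Type) (n : nat) (x : 'I_n -> T) (S : {set 'I_n}) : seq T :=
  [seq x i | i in S].

Section Linfty.
Variable k : fieldType.
Implicit Types V W : superspace k.

(* The value at (x_0, ..., x_{n-1}) of f \o (coderivation extending m): the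
   subset S goes first into m. *)
Definition comp_coder (U W : superspace k) (f : seq U -> W) (m : seq U -> U)
    (n : nat) (p : 'I_n -> bool) (x : 'I_n -> U) : W :=
  \sum_(S : {set 'I_n}) koszul k p (fun i => i \notin S) *:
    f (m (sub_args x S) :: sub_args x (~: S)).

(* The value at (x_0, ..., x_{n-1}) of m \o (coalgebra map extending f): the
   sum over partitions into r nonempty blocks is the sum over all labellings
   by 'I_r divided by r!; labellings that miss some label contribute 0 because
   [f [::] = 0]. *)
Definition comp_comor (U W : superspace k) (m : seq W -> W) (f : seq U -> W)
    (n : nat) (p : 'I_n -> bool) (x : 'I_n -> U) : W :=
  \sum_(r < n.+1) (r`!%:R : k)^-1 *:
    \sum_(c : {ffun 'I_n -> 'I_r}) koszul k p (fun i => c i) *: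
      m [seq f (sub_args x [set i | c i == j]) | j : 'I_r].

(* Let m* = sum_n m_n* be the derivation of the completed symmetric algebra
   on (Pi V)* dual to the collection m, where S_n-coinvariants are identified
   with S_n-invariants by summing over S_n (hence no factorials below).
   m* \o m* is again a derivation, so it vanishes iff it vanishes on (Pi V)*,
   i.e. iff its components, dual to [comp_coder m m], vanish. *)
Definition Linfty_structure V (m : seq (Pi V) -> Pi V) : Prop :=
  multimap true m /\
  forall (n : nat) (p : 'I_n -> bool) (x : 'I_n -> Pi V),
    (forall i, homog (p i) (x i)) -> comp_coder m m p x = 0.

(* f* \o mW* and mV* \o f* are derivations along the algebra morphism f*, so
   they agree iff they agree on (Pi W)*, which is the identity below. *)
Definition Linfty_map V W (mV : seq (Pi V) -> Pi V) (mW : seq (Pi W) -> Pi W)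
    (f : seq (Pi V) -> Pi W) : Prop :=
  multimap false f /\
  forall (n : nat) (p : 'I_n -> bool) (x : 'I_n -> Pi V),
    (forall i, homog (p i) (x i)) ->
    comp_coder f mV p x = comp_comor mW f p x.

(* The linear part of f is bijective on homology of the linear parts. *)
Definition Linfty_qiso V W (mV : seq (Pi V) -> Pi V) (mW : seq (Pi W) -> Pi W)
    (f : seq (Pi V) -> Pi W) : Prop :=
  [/\ Linfty_map mV mW f,
      (forall v, mV [:: v] = 0 -> (exists w, f [:: v] = mW [:: w]) ->
         exists u, v = mV [:: u]) &
      (forall w, mW [:: w] = 0 ->
         exists2 v, mV [:: v] = 0 & exists u, w - f [:: v] = mW [:: u])].

Definition Linfty_qisomorphic V W (mV : seq (Pi V) -> Pi V)
    (mW : seq (Pi W) -> Pi W) : Prop :=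
  (exists f, Linfty_qiso mV mW f) \/ (exists f, Linfty_qiso mW mV f).

Definition abelian_Linfty V (m : seq (Pi V) -> Pi V) : Prop :=
  forall s : seq (Pi V), (2 <= size s)%N -> m s = 0.

Definition homotopy_abelian V (m : seq (Pi V) -> Pi V) : Prop :=
  exists (W : superspace k) (mW : seq (Pi W) -> Pi W),
    [/\ Linfty_structure mW, abelian_Linfty mW & Linfty_qisomorphic m mW].

End Linfty.

(* m_n(a_1, ..., a_n) = [[...[D_{n-1}, a_1], ...], a_n](1), on the space
   Pi (Pi A), which has the same elements and the same grading as A. *)
Definition bv_op (k : fieldType) (A : BVinfty k) (s : seq (Pi (Pi A)))
    : Pi (Pi A) :=
  if s is [::] then 0 else
  foldl (fun P a => scomm P (smul a)) (bvD A (size s).-1 : A -> A)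
    (s : seq A) (sone A).

(* Main.v *)
From HB Require Import structures.
Require Import Defs.
From mathcomp Require Import all_boot all_order all_algebra finmap.
From mathcomp Require Import boolp classical_sets functions.
From mathcomp Require Import zify.

Set Implicit Arguments.
Unset Strict Implicit.
Unset Printing Implicit Defensive.
Import GRing.Theory.
Local Open Scope ring_scope.

(** The abelian model is A itself with the differential D_0 and no higher
    operations, and the quasi-isomorphism is an L-infinity map f from it to
    (A, m) whose linear part is the identity. Write D = D_0 + h D_1 + ...
    acting on power series in h with coefficients in A.

    Degeneration is used once: it makes every D_0-cycle of A the constant term
    of a D-cycle ([extend_cycle]), and hence provides an even power series psi
    of operators with constant term 1 and D psi = psi D_0 ([trivialisation]).
    Let phi be its inverse.

    A family of symmetric multilinear maps on A with values in power series is
    handled as a function g on words whose letters are elements of A with a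
    declared parity. Such functions form a graded commutative algebra under
    convolution ([conv]). Let nabla F (s) be the signed sum of the values of F
    on the words obtained by applying D_0 to one letter of s. If g(s) is
    divisible by h^(n-1), where n is the length of s, and if
    D(e^g) = nabla(e^g), then the coefficients of h^(n-1) in the values g(s)
    form an L-infinity map. Indeed, conjugating by e^g turns the equation into
    sum_r [...[D, g], ..., g](1) / r! = nabla g, with r commutators in the r-th
    term. As D_i has order i + 1, only the commutators with D_i for i >= r - 1
    contribute, so the left-hand side is divisible by h^(n-1) too, and only
    D_(r-1) contributes to its coefficient of h^(n-1) ([iter_bracket_lead]).
    There the operations m_r appear.

    The function g is found by recursion on the length of words
    ([exists_linfty_series]). At a word s of length n the value of e^g is
    g(s) + e, where e only involves g on shorter words. Define g(s) by
    requiring that phi(e^g(s)) have no terms of degree at least n - 1, apart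
    from the letter itself when n = 1. Let P be the difference of D and nabla.
    If P(e^g) vanishes on shorter words then P(e^g)(s) equals
    (e^(-g) P e^g)(s) ([exp_ad_leading]), which is divisible by h^(n-1) by the
    order condition. Hence phi(P(e^g)(s)) has no terms of degree less than
    n - 1. It has none of higher degree either: phi turns D into D_0, which,
    like nabla, does not change degrees in h. So P(e^g)(s) = 0. *)

(** * Linear algebra: subspaces, projections and lifts *)

Section Linear.
Variables (k : fieldType) (U V : lmodType k) (P : U -> V).
Hypothesis P_lin : linear P.

Let Plin : {linear U -> V} :=
  HB.pack P (GRing.isLinear.Build k U V _ P P_lin).

Lemma lin0 : P 0 = 0. Proof. exact: (linear0 Plin). Qed.
Lemma linD x y : P (x + y) = P x + P y. Proof. exact: (linearD Plin). Qed.
Lemma linB x y : P (x - y) = P x - P y. Proof. exact: (linearB Plin). Qed.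
Lemma linZ c x : P (c *: x) = c *: P x. Proof. exact: (linearZZ Plin). Qed.
Lemma lin_sum I (r : seq I) (Q : pred I) (F : I -> U) :
  P (\sum_(i <- r | Q i) F i) = \sum_(i <- r | Q i) P (F i).
Proof. exact: (linear_sum Plin). Qed.
End Linear.

Section Lifts.
Variable k : fieldType.

(** Zorn's lemma, applied to the subspaces meeting M only in 0. The union of the
    empty chain is empty, so the sets considered are not required to contain 0;
    maximality restores it. *)
Lemma subspace_complement (U : lmodType k) (M : set U) :
    M 0 -> (forall c x y, M x -> M y -> M (c *: x + y)) ->
  exists C : set U, [/\ C 0, forall c x y, C x -> C y -> C (c *: x + y),
    forall x, C x -> M x -> x = 0 & forall x, exists2 m, M m & C (x - m)].
Proof.
move=> M0 Mlin.
have MZ c x : M x -> M (c *: x) by move=> Mx; rewrite -[c *: x]addr0; apply: Mlin.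
pose good (C : set U) := (forall c x y, C x -> C y -> C (c *: x + y)) /\
  (forall x, C x -> M x -> x = 0).
have [F Fgood Ftot|C [[Clin CM] Cmax]] := @Zorn_bigcup U good.
  split=> [c x y [X FX Xx] [Y FY Yy]|x [X FX Xx]]; last exact: (Fgood _ FX).2.
  have [XY|YX] := Ftot X Y FX FY.
    by exists Y => //; apply: (Fgood _ FY).1 => //; apply: XY.
  by exists X => //; apply: (Fgood _ FX).1 => //; apply: YX.
have C0 : C 0.
  apply: contrapT => nC0; apply: (Cmax (C `|` [set 0])%classic).
    split; first by move=> x Cx; left.
    by move/(_ 0 (or_intror erefl)).
  split=> [c x y [Cx|->] [Cy|->]|x [/CM//|->]//].
  - by left; apply: Clin.
  - have := Clin (-1) x x Cx Cx; rewrite scaleN1r addNr; tauto.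
  - by rewrite scaler0 add0r; left.
  - by rewrite scaler0 add0r; right.
have CZ c x : C x -> C (c *: x) by move=> Cx; rewrite -[c *: x]addr0; apply: Clin.
exists C; split=> // x; apply: contrapT => nx.
pose C' := [set z | exists c a, C c /\ z = a *: x + c]%classic.
apply: (Cmax C').
  split=> [c Cc|C'C]; first by exists c, 0; rewrite scale0r add0r.
  apply: nx; exists 0 => //; rewrite subr0; apply: C'C.
  by exists 0, 1; rewrite scale1r addr0.
split=> [c _ _ [c1 [a1 [Cc1 ->]]] [c2 [a2 [Cc2 ->]]]|_ [c [a [Cc ->]]] Mz].
  exists (c *: c1 + c2), (c * a1 + a2); split; first exact: Clin.
  by rewrite scalerDr scalerA scalerDl addrACA.
have [a0|a0] := eqVneq a 0.
  by move: Mz; rewrite a0 scale0r add0r => Mc; apply: CM.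
case: nx; exists (a^-1 *: (a *: x + c)); first exact: MZ.
rewrite scalerDr scalerA mulVf // scale1r opprD addNKr -scaleNr; exact: CZ.
Qed.

Lemma subspace_projection (U : lmodType k) (M : set U) :
    M 0 -> (forall c x y, M x -> M y -> M (c *: x + y)) ->
  exists P : U -> U, [/\ linear P, forall x, M (P x) & forall x, M x -> P x = x].
Proof.
move=> M0 Mlin; have [C [C0 Clin CM MC]] := subspace_complement M0 Mlin.
have /choice[P PP] : forall x, exists m, M m /\ C (x - m).
  by move=> x; have [m Mm Cm] := MC x; exists m.
have uniqP x m : M m -> C (x - m) -> P x = m.
  have [MP CP] := PP x => Mm Cm; apply/eqP; rewrite -subr_eq0; apply/eqP/CM.
    have -> : P x - m = -1 *: (x - P x) + (x - m).
      by rewrite scaleN1r opprB addrA subrK.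
    exact: Clin.
  by rewrite addrC -scaleN1r; apply: Mlin.
exists P; split=> [c x y|x|x Mx]; [|exact: (PP x).1|by apply: uniqP; rewrite ?subrr].
apply: uniqP; first by apply: Mlin; [case: (PP x)|case: (PP y)].
have -> : c *: x + y - (c *: P x + P y) = c *: (x - P x) + (y - P y).
  by rewrite scalerBr opprD addrACA.
by apply: Clin; [case: (PP x)|case: (PP y)].
Qed.

(** Any choice of preimages becomes linear after subtracting its projection to
    the kernel of T, because the defect of linearity lies in that kernel. *)
Lemma linear_lift (X U V : lmodType k) (R : X -> V) (T : U -> V) :
    linear R -> linear T -> (forall x, exists u, T u = R x) ->
  exists L : X -> U, linear L /\ forall x, T (L x) = R x.
Proof.
move=> Rlin Tlin /choice [u uP].
have [|c x y /= Tx Ty|P [Plin TP Pid]] :=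
    @subspace_projection U [set z | T z = 0]%classic.
- exact: (lin0 Tlin).
- by rewrite /= Tlin Tx Ty scaler0 addr0.
pose Q z := z - P z.
have Qlin : linear Q.
  by move=> c x y; rewrite /Q Plin opprD addrACA scalerBr.
exists (Q \o u); split=> [c x y|x] /=; last by rewrite (linB Tlin) uP TP subr0.
apply/eqP; rewrite -subr_eq0 -Qlin -(linB Qlin) /Q Pid ?subrr //.
by rewrite /= (linB Tlin) Tlin !uP Rlin subrr.
Qed.
End Lifts.

(** * Super vector spaces and supercommutators *)

Lemma sub_lin (k : fieldType) (U : lmodType k) (c e : k) (x y u v : U) :
  c *: x + y - e *: (c *: u + v) = c *: (x - e *: u) + (y - e *: v).
Proof.
by rewrite scalerDr opprD addrACA scalerBr !scalerA [e * c]mulrC.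
Qed.

Section Super.
Variables (k : fieldType) (V : superspace k).
Implicit Types (x y : V) (b c : bool).

Lemma homog0 b : homog b (0 : V).
Proof. by rewrite /homog linear0. Qed.

Lemma homog_lin b (a : k) x y : homog b x -> homog b y -> homog b (a *: x + y).
Proof. by rewrite /homog linearP => -> ->. Qed.

Lemma homogD b x y : homog b x -> homog b y -> homog b (x + y).
Proof. by move=> hx hy; rewrite -[x]scale1r; apply: homog_lin. Qed.

Lemma homogZ b (a : k) x : homog b x -> homog b (a *: x).
Proof.
by move=> hx; rewrite -[_ *: _]addr0; apply: homog_lin => //; apply: homog0.
Qed.

Lemma homogB b x y : homog b x -> homog b y -> homog b (x - y).
Proof. by move=> hx hy; rewrite -[- y]scaleN1r; apply/homogD/homogZ. Qed.

Lemma homog_sum b I (r : seq I) (P : pred I) (F : I -> V) :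
  (forall i, P i -> homog b (F i)) -> homog b (\sum_(i <- r | P i) F i).
Proof.
by move=> hF; elim/big_ind: _ => //; [apply: homog0 | apply: homogD].
Qed.

Lemma homog_spr b x : homog b (spr V b x).
Proof. by rewrite /homog spr_spr eqxx. Qed.

Lemma spr_homog b c x : homog b x -> spr V c x = if c == b then x else 0.
Proof. by move=> <-; rewrite spr_spr. Qed.

Lemma sum_spr x : \sum_(b : bool) spr V b x = x.
Proof. by rewrite big_bool /= addrC spr_sum. Qed.

End Super.

Definition op_parity (k : fieldType) (V W : superspace k) c (P : V -> W) :=
  forall b x, homog b x -> homog (c (+) b) (P x).

Lemma hpart_op_parity (k : fieldType) (V : superspace k) (c d : bool) (P : V -> V) x :
  linear P -> op_parity c P -> hpart d P x = if d == c then P x else 0.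
Proof.
move=> Plin Ppar; rewrite /hpart.
transitivity (\sum_(e : bool) if d == c then P (spr V e x) else 0).
  apply: eq_bigr => e _.
  rewrite (spr_homog _ (Ppar _ _ (homog_spr e x))) -subr_eq0.
  by case: c d e {Ppar} => [] [] [].
case: (d == c); last by rewrite big1.
by rewrite -(lin_sum Plin) sum_spr.
Qed.

Lemma spr_op_parity (k : fieldType) (V : superspace k) c b (P : V -> V) x :
  linear P -> op_parity c P -> P (spr V b x) = spr V (c (+) b) (P x).
Proof.
move=> Plin Ppar; rewrite -[in RHS](sum_spr x) (lin_sum Plin) linear_sum.
rewrite (bigD1 b) //= big1 ?addr0 => [|d db].
  by rewrite (spr_homog _ (Ppar _ _ (homog_spr b x))) eqxx.
by rewrite (spr_homog _ (Ppar _ _ (homog_spr d x))); case: c b d db {Ppar} => [] [] [].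
Qed.

Section Product.
Variables (k : fieldType) (A : scomalg k).
Implicit Types (x y z a : A).

Lemma smul_lin_l z : linear (fun x => smul x z).
Proof. by move=> c x y; apply: smul_linl. Qed.

Lemma smul_lin_r z : linear (smul z).
Proof. by move=> c x y; apply: smul_linr. Qed.

Lemma op_parity_smul b a : homog b a -> op_parity b (smul a).
Proof. by move=> ha c x hx; apply: smul_homog. Qed.

(** The double sum over homogeneous parts in the definition of the commutator
    has a single nonzero term. *)
Lemma scommE c b (P : A -> A) a x : linear P -> op_parity c P -> homog b a ->
  scomm P (smul a) x =
    P (smul a x) - (-1) ^+ (c && b) *: smul a (P x).
Proof.
move=> Plin Ppar ha; rewrite /scomm (bigD1 c) //= [X in _ + X]big1 ?addr0.
  rewrite (bigD1 b) //= [X in _ + X]big1 ?addr0.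
    rewrite !(hpart_op_parity _ _ Plin Ppar).
    rewrite !(hpart_op_parity _ _ (smul_lin_r a) (op_parity_smul ha)).
    by rewrite !eqxx.
  move=> d /negPf db; rewrite !(hpart_op_parity _ _ Plin Ppar).
  rewrite !(hpart_op_parity _ _ (smul_lin_r a) (op_parity_smul ha)) db.
  by rewrite /= eqxx (lin0 Plin) scaler0 subrr.
move=> d /negPf db; rewrite big1 // => e _; rewrite !(hpart_op_parity _ _ Plin Ppar).
rewrite !(hpart_op_parity _ _ (smul_lin_r a) (op_parity_smul ha)) db.
by rewrite (lin0 (smul_lin_r a)) if_same scaler0 subrr.
Qed.

Lemma scomm_linl (Q : A -> A) (c : k) (P1 P2 : A -> A) : linear Q ->
  scomm (c *: P1 + P2) Q = c *: scomm P1 Q + scomm P2 Q.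
Proof.
move=> Qlin; apply: funext => x.
have hl b y : hpart b (c *: P1 + P2) y = c *: hpart b P1 y + hpart b P2 y.
  rewrite /hpart scaler_sumr -big_split /=; apply: eq_bigr => d _.
  by rewrite -linearP.
have hQ b : linear (hpart b Q).
  move=> e y z; rewrite /hpart scaler_sumr -big_split /=; apply: eq_bigr => d _.
  by rewrite linearP Qlin linearP.
rewrite -[RHS]/(c *: scomm P1 Q x + scomm P2 Q x) /scomm.
rewrite scaler_sumr -big_split /=; apply: eq_bigr => b _.
rewrite scaler_sumr -big_split /=; apply: eq_bigr => d _.
by rewrite !hl hQ sub_lin.
Qed.

Lemma scomm_linr (P : A -> A) (c : k) a1 a2 : linear P ->
  scomm P (smul (c *: a1 + a2)) =
    c *: scomm P (smul a1) + scomm P (smul a2).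
Proof.
move=> Plin; apply: funext => x.
have hl b y : hpart b (smul (c *: a1 + a2)) y =
    c *: hpart b (smul a1) y + hpart b (smul a2) y.
  rewrite /hpart scaler_sumr -big_split /=; apply: eq_bigr => d _.
  by rewrite (smul_lin_l _) linearP.
have hQ b : linear (hpart b P).
  move=> e y z; rewrite /hpart scaler_sumr -big_split /=; apply: eq_bigr => d _.
  by rewrite linearP Plin linearP.
rewrite -[RHS]/(c *: scomm P (smul a1) x + scomm P (smul a2) x) /scomm.
rewrite scaler_sumr -big_split /=; apply: eq_bigr => b _.
rewrite scaler_sumr -big_split /=; apply: eq_bigr => d _.
by rewrite !hl hQ sub_lin.
Qed.

Lemma scomm_lin (P : A -> A) a : linear P -> linear (scomm P (smul a)).
Proof.
move=> Plin c x y.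
have hQ (Q : A -> A) b : linear Q -> linear (hpart b Q).
  move=> Ql e u v; rewrite /hpart scaler_sumr -big_split /=.
  by apply: eq_bigr => d _; rewrite linearP Ql linearP.
have hP := hQ P _ Plin; have hs := hQ (smul a) _ (smul_lin_r a).
rewrite /scomm scaler_sumr -big_split /=; apply: eq_bigr => b _.
rewrite scaler_sumr -big_split /=; apply: eq_bigr => d _.
by rewrite hs hP hP hs sub_lin.
Qed.

Lemma op_parity_scomm c b (P : A -> A) a : linear P -> op_parity c P -> homog b a ->
  op_parity (c (+) b) (scomm P (smul a)).
Proof.
move=> Plin Ppar ha d x hx; rewrite (scommE _ Plin Ppar ha); apply: homogB.
  by rewrite -addbA; apply: Ppar; apply: smul_homog.
by rewrite [c (+) b]addbC -addbA; apply/homogZ/smul_homog => //; apply: Ppar.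
Qed.

Lemma in_Fpred_lin n (c : k) (P1 P2 : A -> A) :
  in_Fpred n P1 -> in_Fpred n P2 -> in_Fpred n (c *: P1 + P2).
Proof.
elim: n P1 P2 => [|n IH] P1 P2 /= h1 h2.
  by move=> x; rewrite -[LHS]/(c *: P1 x + P2 x) h1 h2 scaler0 addr0.
by move=> a; rewrite scomm_linl; [apply: IH|apply: smul_lin_r].
Qed.

Lemma scomm0 (P : A -> A) : linear P -> scomm 0 P = 0.
Proof.
by move=> Pl; have := scomm_linl (-1) 0 0 Pl; rewrite scaler0 addr0 scaleN1r addNr.
Qed.

Lemma in_Fpred0 n : in_Fpred n (0 : A -> A).
Proof.
elim: n => [|n IH] //= a; rewrite scomm0 //; exact: smul_lin_r.
Qed.

Lemma in_Fpred_mono m n (P : A -> A) : (m <= n)%N -> in_Fpred m P -> in_Fpred n P.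
Proof.
elim: n m P => [|n IH] [|m] P //=; last by move=> mn h a; apply: (IH m).
move=> _ h a; have -> : P = 0 by apply: funext.
by rewrite scomm0; [apply: in_Fpred0|apply: smul_lin_r].
Qed.

Lemma in_Fpred_sum n I (r : seq I) (P : pred I) (F : I -> A -> A) :
  (forall i, P i -> in_Fpred n (F i)) -> in_Fpred n (\sum_(i <- r | P i) F i).
Proof.
move=> hF; elim/big_ind: _ => //; first exact: in_Fpred0.
by move=> P1 P2 h1 h2; rewrite -[P1]scale1r; apply: in_Fpred_lin.
Qed.

End Product.

(** Recursion on a measure without well-founded recursion: the iterates of F
    stabilise at s after one step more than the measure of s. *)
Lemma measure_fixpoint (S : Type) (W : Type) (w0 : W) (mu : S -> nat)
    (F : (S -> W) -> S -> W) :
    (forall g g' s, (forall t, (mu t < mu s)%N -> g t = g' t) -> F g s = F g' s) ->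
  exists g, forall s, g s = F g s.
Proof.
move=> Floc; pose gs n := iter n F (fun=> w0).
have stab n s : (mu s < n)%N -> gs n s = gs n.+1 s.
  elim: n s => // n IH s sn; apply: Floc => t ts.
  by apply: IH; apply: leq_trans ts _.
have stabD n m s : (mu s < n)%N -> gs n s = gs (m + n)%N s.
  move=> sn; elim: m => // m ->; rewrite addSn -stab //.
  exact: leq_trans sn (leq_addl _ _).
exists (fun s => gs (mu s).+1 s) => s; apply: Floc => t ts.
by rewrite (stabD _ (mu s - (mu t).+1)%N) ?subnK.
Qed.

(** The reindexing behind the associativity of Cauchy products, here for an
    arbitrary ternary term. *)
Lemma cauchy_assoc (V : nmodType) (T : nat -> nat -> nat -> V) n :
  \sum_(i < n.+1) \sum_(j < (n - i).+1) T i j (n - i - j)%N =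
  \sum_(m < n.+1) \sum_(i < m.+1) T i (m - i)%N (n - m)%N.
Proof.
elim: n T => [|n IH] T; first by rewrite !big_ord1.
rewrite big_ord_recl /= subn0.
under [X in _ + X]eq_bigr => i _ do rewrite subSS.
rewrite (IH (fun i => T i.+1)) [RHS]big_ord_recl big_ord1 /= subn0.
rewrite big_ord_recl /= !subn0 -addrA; congr (_ + _).
rewrite -big_split /=; apply: eq_bigr => i _.
rewrite [RHS]big_ord_recl /= subn0 !subSS; congr (_ + _).
Qed.

Lemma sum_rev (V : nmodType) (T : nat -> nat -> V) n :
  \sum_(i < n.+1) T i (n - i)%N = \sum_(i < n.+1) T (n - i)%N i.
Proof.
rewrite (reindex_inj rev_ord_inj) /=; apply: eq_bigr => i _.
by rewrite subSS subKn // -ltnS.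
Qed.

Lemma sum_fctE (k : fieldType) (T : Type) (V : lmodType k) I (r : seq I) (P : pred I)
    (F : I -> T -> V) x :
  (\sum_(i <- r | P i) F i) x = \sum_(i <- r | P i) F i x.
Proof. by elim/big_rec2: _ => // i y f _ <-. Qed.

(** * Formal power series and series of operators *)

(** Power series are functions of the exponent of h. Here the operator
    Q_0 + h Q_1 + ... acts on u_0 + h u_1 + ... *)
Definition serop (U : Type) (V : nmodType) (Q : nat -> U -> V) (u : nat -> U) :
    nat -> V :=
  fun n => \sum_(i < n.+1) Q i (u (n - i)%N).

Definition sercomp (U W : Type) (V : nmodType) (Q : nat -> W -> V) (R : nat -> U -> W) :
  nat -> U -> V :=
  fun n x => \sum_(i < n.+1) Q i (R (n - i)%N x).

Definition vanish_below (V : nmodType) (m : nat) (u : nat -> V) :=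
  forall i, (i < m)%N -> u i = 0.

Section Series.
Variable k : fieldType.
Implicit Types U V W : lmodType k.

Lemma serop_lin U V (Q : nat -> U -> V) :
  (forall i, linear (Q i)) -> linear (serop Q).
Proof.
move=> Qlin c u v; apply: funext => n.
rewrite -[RHS]/(c *: serop Q u n + serop Q v n) /serop scaler_sumr -big_split /=.
by apply: eq_bigr => i _; rewrite Qlin.
Qed.

Lemma serop_comp U V W (Q : nat -> W -> V) (R : nat -> U -> W) u :
  (forall i, linear (Q i)) -> serop Q (serop R u) = serop (sercomp Q R) u.
Proof.
move=> Qlin; apply: funext => n; rewrite /serop /sercomp.
rewrite -(cauchy_assoc (fun i j l => Q i (R j (u l)))).
by apply: eq_bigr => i _; rewrite (lin_sum (Qlin i)).
Qed.

Lemma vanish_below_serop U V (Q : nat -> U -> V) m u :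
  (forall i, linear (Q i)) -> vanish_below m u -> vanish_below m (serop Q u).
Proof.
move=> Qlin um n nm; rewrite /serop big1 // => i _.
by rewrite um ?(lin0 (Qlin _)) // (leq_ltn_trans (leq_subr _ _)).
Qed.

Definition const_series V (a : V) : nat -> V := fun n => if n is 0 then a else 0.

Lemma const_series_lin V : linear (@const_series V).
Proof.
move=> c x y; apply: funext => -[//|n].
by rewrite -[RHS]/(c *: 0 + 0) scaler0 addr0.
Qed.

Lemma serop_const_series U V (Q : nat -> U -> V) a n :
  (forall i, linear (Q i)) -> serop Q (const_series a) n = Q n a.
Proof.
move=> Qlin; rewrite /serop big_ord_recr /= subnn big1 ?add0r // => i _.
by rewrite -(subnSK (ltn_ord i)) /= (lin0 (Qlin _)).
Qed.

Definition coefwise U V (P : U -> V) : nat -> U -> V :=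
  fun n => if n is 0 then P else fun=> 0.

Lemma coefwise_lin U V (P : U -> V) n : linear P -> linear (coefwise P n).
Proof. by case: n => [//|n] _ c x y; rewrite /= scaler0 addr0. Qed.

Lemma serop_coefwise U V (P : U -> V) u n : serop (coefwise P) u n = P (u n).
Proof. by rewrite /serop big_ord_recl /= subn0 big1 ?addr0. Qed.

Lemma sercomp_coefwiser U V W (Q : nat -> W -> V) (P : U -> W) n x :
  (forall i, linear (Q i)) -> sercomp Q (coefwise P) n x = Q n (P x).
Proof.
move=> Qlin; rewrite /sercomp big_ord_recr /= subnn big1 ?add0r // => i _.
by rewrite -(subnSK (ltn_ord i)) /= (lin0 (Qlin _)).
Qed.

Section Inverse.
Variables (V : lmodType k) (psi : nat -> V -> V).
Hypotheses (psi_lin : forall i, linear (psi i)) (psi0 : forall x, psi 0%N x = x).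

Lemma serop_inj u v : serop psi u = serop psi v -> u = v.
Proof.
move=> e; apply: funext => n; elim/ltn_ind: n => n IH.
have := congr1 (@^~ n) e; rewrite /serop !big_ord_recl /= !subn0 !psi0.
rewrite (eq_bigr (fun i : 'I_n => psi (bump 0 i) (v (n - bump 0 i)%N))).
  exact: addIr.
by move=> i _; rewrite IH // -subn_gt0 subKn //.
Qed.

Lemma serop_surj u : exists v, serop psi v = u.
Proof.
have [|v vP] := @measure_fixpoint nat V 0 id
    (fun v n => u n - \sum_(i < n) psi i.+1 (v (n - i.+1)%N)).
  move=> g g' n h; congr (_ - _); apply: eq_bigr => i _; rewrite h //=.
  by rewrite -subn_gt0 subKn.
exists v; apply: funext => n; rewrite /serop big_ord_recl /= psi0 subn0 vP subrK //.
Qed.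

(** A power series of operators with constant term the identity is invertible:
    the coefficients of the inverse image are solved for successively. *)
Lemma series_inverse : exists phi : (nat -> V) -> (nat -> V),
  [/\ linear phi, cancel phi (serop psi) & cancel (serop psi) phi].
Proof.
have /choice [phi phiK] := serop_surj.
exists phi; split=> // [c u v|u]; apply: serop_inj; rewrite ?phiK //.
by rewrite (serop_lin psi_lin) !phiK.
Qed.
End Inverse.
End Series.

(** * The algebra of power series *)
Section PowerSeriesAlgebra.
Variables (k : fieldType) (A : scomalg k).
Implicit Types (u v w : nat -> A).

Definition pmul u v : nat -> A := serop (fun i => smul (u i)) v.
Definition phomog b u := forall n, homog b (u n).

Lemma pmul_linr u : linear (pmul u).
Proof. by apply: serop_lin => i; apply: smul_lin_r. Qed.

Lemma pmul_linl v : linear (pmul^~ v).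
Proof.
move=> c u u'; apply: funext => n.
rewrite -[RHS]/(c *: pmul u v n + pmul u' v n) /pmul /serop scaler_sumr -big_split /=.
by apply: eq_bigr => i _; rewrite (smul_lin_l _).
Qed.

Lemma pmulA u v w : pmul u (pmul v w) = pmul (pmul u v) w.
Proof.
rewrite /pmul serop_comp; last by move=> i; apply: smul_lin_r.
apply: funext => n; apply: eq_bigr => i _; rewrite (lin_sum (smul_lin_l _)).
by apply: eq_bigr => j _; rewrite smulA.
Qed.

Lemma pmul_homog b c u v : phomog b u -> phomog c v -> phomog (b (+) c) (pmul u v).
Proof. by move=> hu hv n; apply: homog_sum => i _; apply: smul_homog. Qed.

Lemma pmulC b c u v : phomog b u -> phomog c v ->
  pmul u v = (-1) ^+ (b && c) *: pmul v u.
Proof.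
move=> hu hv; apply: funext => n; rewrite -[RHS]/(_ *: pmul v u n).
rewrite /pmul /serop scaler_sumr (sum_rev (fun i j => smul (u i) (v j))).
by apply: eq_bigr => i _; rewrite (smulC (hu _) (hv _)).
Qed.

Lemma pmul1r u : pmul u (const_series (sone A)) = u.
Proof.
by apply: funext => n; rewrite /pmul serop_const_series ?smulx1 // => i; apply: smul_lin_r.
Qed.

Lemma phomog_serop c b (Q : nat -> A -> A) u :
  (forall i, op_parity c (Q i)) -> phomog b u -> phomog (c (+) b) (serop Q u).
Proof. by move=> hQ hu n; apply: homog_sum => i _; apply: hQ. Qed.

Definition pbracket (Q : nat -> A -> A) u : nat -> A -> A :=
  fun n => \sum_(i < n.+1) scomm (Q i) (smul (u (n - i)%N)).

(** Commutators may be computed coefficientwise, so that statements on the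
    orders of the individual coefficients apply to operators on series. *)
Lemma pbracketE c b (Q : nat -> A -> A) u v :
    (forall i, linear (Q i)) -> (forall i, op_parity c (Q i)) -> phomog b u ->
  serop (pbracket Q u) v =
  serop Q (pmul u v) - (-1) ^+ (c && b) *: pmul u (serop Q v).
Proof.
move=> Ql Qp hu; rewrite /pmul !serop_comp //; last by move=> i; apply: smul_lin_r.
apply: funext => n; rewrite -[RHS]/(serop _ v n - _ *: serop _ v n).
rewrite /serop scaler_sumr -sumrB; apply: eq_bigr => m _.
rewrite /sercomp (sum_rev (fun i j => smul (u i) (Q j (v (n - m)%N)))).
rewrite scaler_sumr -sumrB /pbracket sum_fctE; apply: eq_bigr => i _.
by rewrite (scommE _ (Ql _) (Qp _) (hu _)).
Qed.

Lemma pbracket_lin (Q : nat -> A -> A) u n :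
  (forall i, linear (Q i)) -> linear (pbracket Q u n).
Proof.
move=> Ql c x y; rewrite /pbracket !sum_fctE scaler_sumr -big_split /=.
by apply: eq_bigr => i _; rewrite (scomm_lin _ (Ql _)).
Qed.

Lemma pbracket_op_parity c b (Q : nat -> A -> A) u n :
    (forall i, linear (Q i)) -> (forall i, op_parity c (Q i)) -> phomog b u ->
  op_parity (c (+) b) (pbracket Q u n).
Proof.
move=> Ql Qp hu d x hx; rewrite /pbracket sum_fctE; apply: homog_sum => i _.
by apply: (op_parity_scomm (Ql _) (Qp _) (hu _)).
Qed.

End PowerSeriesAlgebra.

(** * Consequences of the degeneration property *)

Lemma sum_antidiagonal (V : nmodType) (F : nat -> nat -> V) N i : (i < N)%N ->
  \sum_(j < N) \sum_(l < N | (j + l == i)%N) F j l = \sum_(j < i.+1) F j (i - j)%N.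
Proof.
move=> iN; rewrite (big_ord_widen N (fun j => F j (i - j)%N)) // [RHS]big_mkcond.
apply: eq_bigr => j _; case: ltnP => [ji|ij].
  have lN : (i - j < N)%N by lia.
  rewrite (big_pred1 (Ordinal lN)) // => l /=.
  by apply/eqP/eqP => [e|-> /=]; [apply: val_inj => /=; lia|lia].
by rewrite big_pred0 // => l; apply/negbTE/eqP; lia.
Qed.

Section ExtendCycles.
Variables (k : fieldType) (A : BVinfty k).
Implicit Types (u v : nat -> A).

Definition bv_ops : nat -> A -> A := fun i => bvD A i.
Definition Dh : (nat -> A) -> (nat -> A) := serop bv_ops.

Lemma bv_ops_lin i : linear (bv_ops i). Proof. exact: linearP. Qed.
Lemma Dh_lin : linear Dh. Proof. by apply: serop_lin; apply: bv_ops_lin. Qed.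

Lemma Dh_Dh u : Dh (Dh u) = 0.
Proof.
rewrite /Dh serop_comp; last exact: bv_ops_lin.
apply: funext => n; rewrite /serop big1 // => i _; exact: bvD_sq.
Qed.

Definition scale_series (c : nat -> k) u : nat -> A := serop (fun i x => c i *: x) u.

Lemma Dh_scale_series c u : Dh (scale_series c u) = scale_series c (Dh u).
Proof.
have clin i : linear (fun x : A => c i *: x).
  by move=> d x y; rewrite scalerDr !scalerA mulrC.
rewrite /Dh /scale_series (serop_comp _ _ bv_ops_lin) (serop_comp _ _ clin).
apply: funext => n; apply: eq_bigr => i _.
rewrite /sercomp (sum_rev (fun a b => c a *: bv_ops b _)); apply: eq_bigr => j _.
by rewrite /bv_ops linearZZ.
Qed.

Definition mulh u : nat -> A := fun n => if n is n'.+1 then u n' else 0.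
Definition divh u : nat -> A := fun n => u n.+1.

Lemma Dh_mulh u : Dh (mulh u) = mulh (Dh u).
Proof.
apply: funext => -[|n]; first by rewrite /Dh /serop big_ord1 /= /bv_ops linear0.
rewrite /Dh /serop big_ord_recr /= subnn /bv_ops linear0 addr0.
by apply: eq_bigr => i _; rewrite subSn // -ltnS.
Qed.

Lemma Dh_divh u : u 0%N = 0 -> Dh (divh u) = divh (Dh u).
Proof.
move=> u0; apply: funext => n; rewrite /divh {2}/Dh /serop big_ord_recr /= subnn u0.
rewrite {2}/bv_ops linear0 addr0.
by apply: eq_bigr => i _; rewrite subSn // -ltnS.
Qed.

(** Series are truncated to compare the operator D with the differential induced
    on A[h]/(h^N). *)
Definition res N u : trunc A N := [ffun i : 'I_N => u i].
Definition lift_trunc N (a : trunc A N) : nat -> A :=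
  fun n => if insub n is Some i then a i else 0.

Lemma lift_truncK N (a : trunc A N) : res N (lift_trunc a) = a.
Proof. by apply/ffunP => i; rewrite ffunE /lift_trunc valK. Qed.

Lemma hD_res N u : hD (res N u) = res N (Dh u).
Proof.
apply/ffunP => i; rewrite !ffunE.
under eq_bigr => j _ do under eq_bigr => l _ do rewrite ffunE.
by rewrite (sum_antidiagonal (fun j l => bvD A j (u l))).
Qed.

Lemma hscale_res N (c : {poly %/ 'X^N : {poly k}}) u :
  hscale c (res N u) = res N (scale_series (nth 0 (c : {poly k})) u).
Proof.
apply/ffunP => i; rewrite !ffunE.
under eq_bigr => j _ do under eq_bigr => l _ do rewrite ffunE.
by rewrite (sum_antidiagonal (fun j l => (c : {poly k})`_j *: u l)).
Qed.

Lemma scale_series_top N (c : k) u n : (n < N.+1)%N ->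
  scale_series (nth 0 (c *: 'X^N : {poly k})) u n = if n == N then c *: u 0%N else 0.
Proof.
move=> nN; rewrite /scale_series /serop big_ord_recr /= subnn big1 => [|i _].
  by rewrite add0r coefZ coefXn; case: eqP; rewrite ?mulr1 // mulr0 scale0r.
have iN : val i != N by rewrite neq_ltn (leq_trans (ltn_ord i)).
by rewrite coefZ coefXn (negbTE iN) mulr0 scale0r.
Qed.

Lemma Dh_top N (x : A) n : (n < N.+1)%N ->
  Dh (fun m => if m == N then x else 0) n = if n == N then bvD A 0 x else 0.
Proof.
move=> nN; rewrite /Dh /serop big_ord_recl /= subn0 big1 ?addr0 => [|i _].
  by rewrite /bv_ops; case: eqP; rewrite ?linear0.
rewrite /bv_ops /= ifF ?linear0 //; apply/negbTE; rewrite neq_ltn /bump.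
by rewrite -ltnS (leq_trans _ nN) // ltnS -subn_gt0 subKn //.
Qed.

(** In a free module over k[h]/(h^(N+1)) an element killed by h^N is divisible
    by h. A cycle u without constant term is killed by h^N; hence, up to a
    boundary, it is h times a combination w of the basis cycles. *)
Lemma divisible_cycle N u : homology_free A N.+1 ->
    u 0%N = 0 -> (forall n, (n < N.+1)%N -> Dh u n = 0) ->
  exists w a, [/\ forall n, (n < N.+1)%N -> Dh w n = 0,
     Dh a 0%N = 0 & forall n, (n < N.+1)%N -> u n = mulh w n + Dh a n].
Proof.
move=> [I [e [De H]]] u0 Du.
have Dures : hD (res N.+1 u) = 0.
  by rewrite hD_res; apply/ffunP => i; rewrite !ffunE Du.
have [c [[a ca] _]] := H _ Dures.
pose C i := nth 0 (c i : {poly k}).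
pose E i := lift_trunc (e i); pose a' := lift_trunc a.
have De' i n : (n < N.+1)%N -> Dh (E i) n = 0.
  move=> nN; have := De i; rewrite -(lift_truncK (e i)) hD_res.
  by move/ffunP/(_ (Ordinal nN)); rewrite !ffunE.
have uE n : (n < N.+1)%N ->
    u n = \sum_(i <- finsupp c) scale_series (C i) (E i) n + Dh a' n.
  move=> nN; move/ffunP/(_ (Ordinal nN)): ca; rewrite -(lift_truncK a) hD_res.
  rewrite !ffunE sum_ffunE => <-.
  have eE i : hscale (c i) (e i) (Ordinal nN) = scale_series (C i) (E i) n.
    by rewrite -(lift_truncK (e i)) hscale_res ffunE.
  by rewrite (eq_bigr _ (fun i _ => eE i)) addrC subrK.
have c0 i : (c i : {poly k})`_0 = 0.
  have [ic|] := boolP (i \in finsupp c); last first.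
    by move/fsfun_dflt ->; rewrite coef0.
  pose q j : {poly %/ 'X^(N.+1) : {poly k}} := in_qpoly 'X^(N.+1) (C j 0%N *: 'X^N).
  have qE j : (q j : {poly k}) = C j 0%N *: 'X^N.
    apply: in_qpoly_small; rewrite /mk_monic size_polyXn monicXn /=.
    by apply: leq_ltn_trans (size_scale_leq _ _) _; rewrite !size_polyXn.
  pose c' : {fsfun I -> {poly %/ 'X^(N.+1) : {poly k}} with 0} :=
    [fsfun j in finsupp c => q j].
  have c'E j : c' j = q j.
    rewrite fsfunE; case: ifP => // /negbT /fsfun_dflt cj.
    by apply/val_inj/esym; rewrite [LHS]qE /C cj coef0 scale0r.
  pose v : nat -> A := fun n => if n == N then a' 0%N else 0.
  have z0 : hD (0 : trunc A N.+1) = 0.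
    have -> : (0 : trunc A N.+1) = res N.+1 0 by apply/ffunP => j; rewrite !ffunE.
    by rewrite hD_res (lin0 Dh_lin).
  have [c0 [_ cU]] := H 0 z0.
  have c0E : c0 = c'.
    apply: cU; exists (res N.+1 v); rewrite hD_res.
    rewrite (big_fset_incl _ (finsupp_sub _ _ _)); last first.
      move=> j _ /fsfun_dflt ->; apply/ffunP => l; rewrite !ffunE.
      by do 2!rewrite big1 // => ? _; rewrite coef0 scale0r.
    apply/ffunP => l; rewrite !ffunE sum_ffunE Dh_top //.
    under eq_bigr => j _ do
      rewrite -(lift_truncK (e j)) hscale_res ffunE c'E qE scale_series_top //.
    rewrite sub0r; case: eqP => _; last by rewrite big1 ?oppr0.
    have := uE 0%N isT; rewrite u0 => /esym/eqP; rewrite addrC addr_eq0 => /eqP.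
    rewrite {1}/Dh /serop big_ord1 subn0 /bv_ops => ->; congr (- _); apply: eq_bigr => j _.
    by rewrite /scale_series /serop big_ord1 subn0.
  have := c'E i; rewrite -c0E.
  have -> : c0 = [fsfun for fun=> 0].
    apply: cU; exists 0; rewrite z0 finsupp0 big_nil subr0 //.
  rewrite fsfun0E => /(congr1 (fun p : {poly %/ 'X^(N.+1)} => (p : {poly k})`_N)).
  rewrite qE coefZ coefXn eqxx mulr1 => c0N; rewrite -[LHS]/(C i 0%N) -c0N; exact: coef0.
have a0 : Dh a' 0%N = 0.
  have := uE 0%N isT; rewrite u0 big1 ?add0r // => i _.
  by rewrite /scale_series /serop big_ord1 /C c0 scale0r.
exists (\sum_(i <- finsupp c) scale_series (fun j => C i j.+1) (E i)), a'; split=> // n nN.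
  rewrite (lin_sum Dh_lin) sum_fctE big1 // => i _; rewrite Dh_scale_series.
  apply: (vanish_below_serop (m := N.+1)) => // [j d x y|m]; last exact: De'.
  by rewrite scalerDr !scalerA mulrC.
rewrite uE //; congr (_ + _); case: n nN => [|n] nN /=.
  by rewrite big1 // => i _; rewrite /scale_series /serop big_ord1 /C c0 scale0r.
rewrite sum_fctE; apply: eq_bigr => i _.
by rewrite /scale_series /serop big_ord_recl /= {1}/C c0 scale0r add0r.
Qed.

(** [divisible_cycle] writes h u as h w + D a, where D a has no constant term.
    Dividing by h, u agrees with the sum of w and (D a)/h, and (D a)/h is a
    cycle to all orders although a/h need not make sense. *)
Lemma extend_truncated_cycle N u : homology_free A N.+2 ->
    (forall n, (n < N.+1)%N -> Dh u n = 0) ->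
  exists v, (forall n, (n < N.+1)%N -> v n = u n) /\
    (forall n, (n < N.+2)%N -> Dh v n = 0).
Proof.
move=> hfree Du; have [//|[|n] nN|w [a [Dw a0 uE]]] := divisible_cycle (u := mulh u) hfree.
- by rewrite Dh_mulh.
- by rewrite Dh_mulh /= Du.
exists (w + divh (Dh a)); split=> n nN.
  by rewrite (uE n.+1 nN : u n = _).
rewrite (linD Dh_lin) -[LHS]/(Dh w n + Dh (divh (Dh a)) n) Dw // add0r.
by rewrite Dh_divh // Dh_Dh.
Qed.

(** The extensions modulo the successive powers of h agree on more and more
    coefficients, and so have a limit. *)
Lemma extend_cycle (z : A) : degeneration A -> bvD A 0 z = 0 ->
  exists u, u 0%N = z /\ Dh u = 0.
Proof.
move=> hdeg z0.
have ext (nu : nat * (nat -> A)) : exists v,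
    (forall n, (n < nu.1.+1)%N -> Dh nu.2 n = 0) ->
    (forall n, (n < nu.1.+1)%N -> v n = nu.2 n) /\
    (forall n, (n < nu.1.+2)%N -> Dh v n = 0).
  have [h|h] := pselect (forall n, (n < nu.1.+1)%N -> Dh nu.2 n = 0).
    by have [v hv] := extend_truncated_cycle (hdeg nu.1.+2 isT) h; exists v.
  by exists 0 => /h.
have /choice[f fP] := ext.
pose us := fix us n := if n is n'.+1 then f (n', us n') else const_series z.
have usP n m : (m < n.+1)%N -> Dh (us n) m = 0.
  elim: n m => [|n IH]; last exact: (fP (n, us n) IH).2.
  by case=> // _; rewrite /Dh /serop big_ord1.
have usS n m d : (m <= n)%N -> us (d + n)%N m = us n m.
  move=> mn; elim: d => // d IH.
  rewrite addSn -IH; apply: (fP ((d + n)%N, us (d + n)%N) (usP _)).1.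
  by rewrite ltnS (leq_trans mn) // leq_addl.
have usE n m : (m <= n)%N -> us n m = us m m.
  by move=> mn; rewrite -{1}(subnK mn) usS.
exists (fun n => us n n); split=> //; apply: funext => n.
rewrite -[RHS](usP n n (leqnn _)) /Dh; apply: eq_bigr => i _.
by rewrite (usE n) // leq_subr.
Qed.

(** Choose a linear S with D_0 S D_0 = D_0, so that 1 - S D_0 projects onto the
    D_0-cycles, and a linear extension sigma of the cycles 1 - S D_0 to D-cycles.
    Then rho = sigma (1 - D_0 S) + D S + S D_0 has constant term 1. It intertwines
    D_0 and D: the first term is killed by D on the left and by D_0 on the right,
    and the other two form a homotopy. The even part of rho has the same
    properties. *)
Lemma trivialisation : degeneration A -> exists psi : nat -> A -> A,
  [/\ forall i, linear (psi i), forall i, op_parity false (psi i),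
      forall x, psi 0%N x = x &
      forall n x, sercomp bv_ops psi n x = psi n (bvD A 0 x)].
Proof.
move=> hdeg.
have D0sq x : bvD A 0 (bvD A 0 x) = 0 by have := bvD_sq 0 x; rewrite big_ord1.
have Dlin i : linear (bvD A i) by apply: linearP.
have D0lin := Dlin 0%N.
(* S lifts a projection onto the image of D_0 along D_0 *)
have [S [Slin DSD]] : exists S : A -> A, linear S /\
    forall x, bvD A 0 (S (bvD A 0 x)) = bvD A 0 x.
  have [|c x y [x' <-] [y' <-]|P [Plin Pim Pid]] :=
      @subspace_projection k A [set y | exists x, bvD A 0 x = y]%classic.
  - by exists 0; rewrite linear0.
  - by exists (c *: x' + y'); rewrite linearP.
  have [S [Slin DS]] := linear_lift Plin D0lin Pim.
  by exists S; split=> // x; rewrite DS Pid //; exists x.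
pose pi x := x - S (bvD A 0 x).
have pilin : linear pi.
  by move=> c x y; rewrite /pi D0lin Slin opprD addrACA scalerBr.
have Dpi x : bvD A 0 (pi x) = 0 by rewrite /pi linearB DSD subrr.
(* the two conditions on the extension are one linear equation in a product *)
have [sigma [slin sP]] : exists s : A -> nat -> A, linear s /\
    forall x, (s x 0%N, Dh (s x)) = (pi x, 0).
  apply: (@linear_lift k A (nat -> A) (A * (nat -> A))%type
    (fun x => (pi x, 0)) (fun u => (u 0%N, Dh u))).
  - by move=> c x y; congr (_, _); rewrite /= ?pilin // scaler0 addr0.
  - by move=> c x y; congr (_, _); rewrite /= ?Dh_lin.
  - by move=> x; have [u [u0 Du]] := extend_cycle hdeg (Dpi x); exists u; rewrite u0 Du.
have s0 x : sigma x 0%N = pi x by have /(congr1 fst) := sP x.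
have Ds x : Dh (sigma x) = 0 by have /(congr1 snd) := sP x.
pose rho x : nat -> A :=
  sigma (x - bvD A 0 (S x)) + (Dh (const_series (S x)) + const_series (S (bvD A 0 x))).
have cstlin := @const_series_lin k A.
have rholin : linear rho.
  move=> c x y; rewrite /rho.
  have -> : c *: x + y - bvD A 0 (S (c *: x + y)) =
      c *: (x - bvD A 0 (S x)) + (y - bvD A 0 (S y)).
    by rewrite Slin linearP opprD addrACA -scalerBr.
  rewrite slin Slin cstlin Dh_lin linearP Slin cstlin !scalerDr.
  by rewrite [RHS]addrACA [X in _ = _ + X]addrACA.
have Drho x : Dh (rho x) = rho (bvD A 0 x).
  rewrite /rho !(linD Dh_lin) Ds Dh_Dh D0sq (lin0 Slin) (lin0 cstlin) DSD subrr.
  by rewrite (lin0 slin) !add0r addr0.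
have rho0 x : rho x 0%N = x.
  rewrite -[LHS]/(sigma _ 0%N + (Dh _ 0%N + S (bvD A 0 x))) s0 /pi.
  rewrite /Dh /serop big_ord1 /= /bv_ops linearB D0sq subr0.
  by rewrite -[x - _ - _]addrA -opprD subrK.
have Dpar i : op_parity true (bvD A i) by move=> b x; apply: bvD_odd.
exists (fun i x => \sum_(b : bool) spr A b (rho (spr A b x) i)); split.
- move=> i c x y; rewrite scaler_sumr -big_split; apply: eq_bigr => b _ /=.
  by rewrite -linearP linearP rholin.
- by move=> i b x hx; rewrite (bigD1 b) //= big1 ?addr0 => [|c cb]; first
    exact: homog_spr; rewrite (spr_homog _ hx) (negbTE cb) (lin0 rholin) linear0.
- by move=> x; under eq_bigr do rewrite rho0 spr_spr eqxx; rewrite sum_spr.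
move=> n x; rewrite [RHS](reindex_inj negb_inj) /=.
under [RHS]eq_bigr => b _ do
  rewrite -[~~ b]/(true (+) b) -(spr_op_parity _ _ D0lin (Dpar 0%N)) -Drho.
rewrite /sercomp /bv_ops; under eq_bigr => i _ do rewrite linear_sum.
rewrite exchange_big; apply: eq_bigr => b _ /=; rewrite linear_sum.
by apply: eq_bigr => i _; rewrite (spr_op_parity _ _ (Dlin _) (Dpar _)).
Qed.
End ExtendCycles.

(** * Signed sums over splittings of a word *)

Section Words.
Variables (k : fieldType) (X : Type) (par : X -> bool).
Implicit Types (s a b c d : seq X) (x y : X) (V W : lmodType k).

Definition spar s : bool := foldr (fun x e => par x (+) e) false s.

Lemma spar_cat a b : spar (a ++ b) = spar a (+) spar b.
Proof. by elim: a => //= x a ->; rewrite addbA. Qed.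

(** The sum of F a b over the ways of distributing the letters of s over two
    subwords a and b, with the Koszul sign of rearranging s into a ++ b. *)
Fixpoint split_sum V s (F : seq X -> seq X -> V) : V :=
  if s is x :: s' then
    split_sum s' (fun a b => F (x :: a) b) +
    split_sum s' (fun a b => (-1) ^+ (par x && spar a) *: F a (x :: b))
  else F [::] [::].

Lemma eq_split_sum V s (F G : seq X -> seq X -> V) :
    (forall a b, (size a + size b)%N = size s -> spar a (+) spar b = spar s ->
       F a b = G a b) ->
  split_sum s F = split_sum s G.
Proof.
elim: s F G => [|x s IH] F G h /=; first exact: h.
congr (_ + _); apply: IH => a b hs hp; rewrite h //= ?addnS ?addSn ?hs //.
  by rewrite -hp addbA.
by rewrite -hp addbCA.
Qed.

Lemma split_sum_lin V W s (P : V -> W) F : linear P ->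
  P (split_sum s F) = split_sum s (fun a b => P (F a b)).
Proof.
move=> Pl; elim: s F => //= x s IH F; rewrite (linD Pl) !IH; congr (_ + _).
by apply: eq_split_sum => a b _ _; rewrite (linZ Pl).
Qed.

Lemma split_sumZ V s (e : k) (F : seq X -> seq X -> V) :
  e *: split_sum s F = split_sum s (fun a b => e *: F a b).
Proof.
by apply: (@split_sum_lin V V s (fun v => e *: v) F) => c u v; rewrite scalerDr !scalerA mulrC.
Qed.

Lemma split_sumD V s (F G : seq X -> seq X -> V) :
  split_sum s (fun a b => F a b + G a b) = split_sum s F + split_sum s G.
Proof.
elim: s F G => //= x s IH F G; rewrite IH addrACA; congr (_ + _).
by rewrite -IH; apply: eq_split_sum => a b _ _; rewrite scalerDr.
Qed.

Lemma split_sum_linear V s (e : k) (F G : seq X -> seq X -> V) :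
  split_sum s (fun a b => e *: F a b + G a b) = e *: split_sum s F + split_sum s G.
Proof. by rewrite split_sumD split_sumZ. Qed.

Lemma split_sum_closed V (K : V -> Prop) s (F : seq X -> seq X -> V) :
    (forall e u v, K u -> K v -> K (e *: u + v)) -> K 0 ->
    (forall a b, (size a + size b)%N = size s -> spar a (+) spar b = spar s ->
       K (F a b)) ->
  K (split_sum s F).
Proof.
move=> Klin K0.
have KZ e u : K u -> K (e *: u) by move=> Ku; rewrite -[_ *: _]addr0; apply: Klin.
elim: s F => [|x s IH] F h /=; first exact: h.
rewrite -[split_sum s _]scale1r; apply: (Klin); apply: IH => a b hs hp; [|apply: KZ];
  apply: h; rewrite /= ?addSn ?addnS ?hs // -hp ?addbA //.
by rewrite -!addbA addbCA.
Qed.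

Lemma split_sum0 V s (F : seq X -> seq X -> V) :
  (forall a b, (size a + size b = size s)%N -> F a b = 0) -> split_sum s F = 0.
Proof.
elim: s F => [|x s IH] F h /=; first exact: h.
by rewrite !IH ?addr0 // => a b hs; rewrite h ?scaler0 //= ?addnS ?addSn ?hs.
Qed.

Lemma split_sumB V s (F G : seq X -> seq X -> V) :
  split_sum s (fun a b => F a b - G a b) = split_sum s F - split_sum s G.
Proof.
rewrite -[- split_sum s G]scaleN1r split_sumZ -split_sumD.
by apply: eq_split_sum => a b _ _; rewrite scaleN1r.
Qed.

Lemma split_sum_sum V s I (r : seq I) (P : pred I) (F : I -> seq X -> seq X -> V) :
  split_sum s (fun a b => \sum_(i <- r | P i) F i a b) =
  \sum_(i <- r | P i) split_sum s (F i).
Proof.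
elim: s F => //= x s IH F; rewrite big_split /= IH; congr (_ + _).
by rewrite -IH; apply: eq_split_sum => a b _ _; rewrite scaler_sumr.
Qed.

Lemma split_sum_flip V s (F : seq X -> seq X -> V) :
  split_sum s F = split_sum s (fun a b => (-1) ^+ (spar a && spar b) *: F b a).
Proof.
elim: s F => [|x s IH] F /=; first by rewrite scale1r.
rewrite addrC; congr (_ + _); rewrite IH; apply: eq_split_sum => a b _ _.
  rewrite !scalerA -!signr_addb; congr (_ ^+ _ *: _).
  by case: (par x) (spar a) (spar b) => [] [] [].
rewrite scalerA -signr_addb; congr (_ ^+ _ *: _).
by case: (par x) (spar a) (spar b) => [] [] [].
Qed.

(** Coassociativity: both sides sum over the distributions of s over three
    subwords. *)
Lemma split_sum_assoc V s (F : seq X -> seq X -> seq X -> V) :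
  split_sum s (fun a e => split_sum e (fun b c => F a b c)) =
  split_sum s (fun e c => split_sum e (fun a b => F a b c)).
Proof.
elim: s F => //= x s IH F; rewrite [in RHS]split_sumD -[RHS]addrA (IH (fun a => F (x :: a))).
congr (_ + _).
rewrite (eq_split_sum (G := fun a e =>
    split_sum e (fun b c => (-1) ^+ (par x && spar a) *: F a (x :: b) c) +
    split_sum e (fun b c => (-1) ^+ (par x && spar a) *:
                       ((-1) ^+ (par x && spar b) *: F a b (x :: c))))); last first.
  by move=> a e _ _; rewrite scalerDr !split_sumZ.
rewrite split_sumD !IH; congr (_ + _); apply: eq_split_sum => e c _ _.
rewrite split_sumZ; apply: eq_split_sum => a b _ <-.
by rewrite scalerA -signr_addb andb_addr.
Qed.

Lemma split_sum_swap V s (F : seq X -> seq X -> seq X -> V) :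
  split_sum s (fun a e => split_sum e (fun b c => F a b c)) =
  split_sum s (fun b e => split_sum e (fun a c => (-1) ^+ (spar a && spar b) *: F a b c)).
Proof.
rewrite !split_sum_assoc; apply: eq_split_sum => e c _ _.
by rewrite split_sum_flip; apply: eq_split_sum => a b _ _; rewrite andbC.
Qed.

Lemma split_sum_nil_l V s (F : seq X -> seq X -> V) :
  (forall a b, a <> [::] -> F a b = 0) -> split_sum s F = F [::] s.
Proof.
elim: s F => //= x s IH F h; rewrite split_sum0 ?add0r => [|a b _]; last exact: h.
rewrite IH => [|a b /h ->]; last by rewrite scaler0.
by rewrite andbF scale1r.
Qed.

Lemma split_sum_nil_r V s (F : seq X -> seq X -> V) :
  (forall a b, b <> [::] -> F a b = 0) -> split_sum s F = F s [::].
Proof.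
elim: s F => //= x s IH F h; rewrite [X in _ + X]split_sum0 ?addr0 => [|a b _].
  by rewrite IH // => a b /h.
by rewrite h ?scaler0.
Qed.

Definition sym_words V (F : seq X -> V) := forall s1 s2 x y,
  F (s1 ++ x :: y :: s2) = (-1) ^+ (par x && par y) *: F (s1 ++ y :: x :: s2).

Lemma split_sum_sym V s1 s2 x y (F : seq X -> seq X -> V) :
    (forall b, sym_words (F^~ b)) -> (forall a, sym_words (F a)) ->
  split_sum (s1 ++ x :: y :: s2) F =
    (-1) ^+ (par x && par y) *: split_sum (s1 ++ y :: x :: s2) F.
Proof.
elim: s1 F => [|z s1 IH] F hl hr /=.
  rewrite !scalerDr !split_sumZ -!addrA; congr (_ + _).
    by apply: eq_split_sum => a b _ _; rewrite (hl b [::]).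
  rewrite addrCA; congr (_ + (_ + _)); apply: eq_split_sum => a b _ _.
  - rewrite scalerA -signr_addb; congr (_ ^+ _ *: _).
    by case: (par x) (par y) (spar a) => [] [] [].
  - rewrite scalerA -signr_addb; congr (_ ^+ _ *: _).
    by case: (par x) (par y) (spar a) => [] [] [].
  rewrite (hr a [::]) !scalerA -!signr_addb; congr (_ ^+ _ *: _).
  by case: (par x) (par y) (spar a) => [] [] [].
rewrite scalerDr !IH ?scalerDr; first by [].
- move=> b t1 t2 u v; rewrite hl !scalerA -!signr_addb !spar_cat /=.
  by rewrite [_ (+) (_ && _)]addbC [par u (+) (_ (+) _)]addbCA.
- by move=> a t1 t2 u v; rewrite (hr a (z :: t1)) !scalerA mulrC.
- by move=> b t1 t2 u v; rewrite (hl b (z :: t1)).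
- by move=> a; apply: hr.
Qed.

(** Linearity of F in each position, relative to a relation R z e x y between
    letters, to be read as z = e x + y. *)
Definition slot_lin (R : X -> k -> X -> X -> Prop) V (F : seq X -> V) :=
  forall s1 s2 z e x y, R z e x y ->
  F (s1 ++ z :: s2) = e *: F (s1 ++ x :: s2) + F (s1 ++ y :: s2).

Lemma split_sum_slot_lin (R : X -> k -> X -> X -> Prop) V
    (F : seq X -> seq X -> V) s1 s2 z e x y :
    (forall z e x y, R z e x y -> par x = par z /\ par y = par z) ->
    (forall b, slot_lin R (F^~ b)) -> (forall a, slot_lin R (F a)) ->
    R z e x y ->
  split_sum (s1 ++ z :: s2) F = e *: split_sum (s1 ++ x :: s2) F + split_sum (s1 ++ y :: s2) F.
Proof.
move=> Rpar hl hr Rz; elim: s1 F hl hr => [|w s1 IH] F hl hr /=.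
  have [-> ->] := Rpar _ _ _ _ Rz.
  rewrite scalerDr addrACA -!split_sum_linear; congr (_ + _); apply: eq_split_sum => a b _ _.
    by rewrite (hl b [::] _ _ _ _ _ Rz).
  by rewrite (hr a [::] _ _ _ _ _ Rz) scalerDr !scalerA mulrC.
rewrite scalerDr addrACA -!IH //.
- move=> b t1 t2 z' e' x' y' R'; rewrite (hl _ _ _ _ _ _ _ R').
  have [hx hy] := Rpar _ _ _ _ R'; rewrite !spar_cat /= hx hy.
  by rewrite scalerDr !scalerA mulrC.
- move=> a t1 t2 z' e' x' y' R'; rewrite (hr a (w :: t1) _ _ _ _ _ R').
  by rewrite scalerDr !scalerA mulrC.
- by move=> b t1 t2 z' e' x' y' R'; rewrite (hl b (w :: t1) _ _ _ _ _ R').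
Qed.

End Words.

(** * The convolution algebra of functions on words *)

Section Convolution.
Variables (k : fieldType) (A : scomalg k) (X : Type) (par : X -> bool).
Notation ps := (nat -> A).
Notation C := (seq X -> nat -> A).
Notation spar := (spar par).
Notation split_sum := (split_sum par).
Implicit Types (s a b c : seq X) (x y z : X) (F G H u : C).

Definition conv F G : C := fun s => split_sum s (fun a b => pmul (F a) (G b)).
(** The sign of moving an odd operator past the letters of a word. *)
Definition tau F : C := fun s => (-1) ^+ spar s *: F s.
Definition unitw : C := fun s => if s is [::] then const_series (sone A) else 0.
Definition evenw F := forall s, phomog (spar s) (F s).

Lemma convA F G H : conv F (conv G H) = conv (conv F G) H.
Proof.
apply: funext => s; rewrite /conv.
transitivity (split_sum s (fun a e => split_sum e (fun b c => pmul (F a) (pmul (G b) (H c))))).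
  by apply: eq_split_sum => a b _ _; apply: (split_sum_lin _ _ _ (pmul_linr _)).
rewrite split_sum_assoc; apply: eq_split_sum => e c _ _.
rewrite (split_sum_lin _ _ _ (pmul_linl (H c))).
by apply: eq_split_sum => a b _ _; rewrite pmulA.
Qed.

Lemma conv_linr F : linear (conv F).
Proof.
move=> e G H; apply: funext => s; rewrite -[RHS]/(e *: conv F G s + conv F H s).
by rewrite /conv -split_sum_linear; apply: eq_split_sum => a b _ _; rewrite -(pmul_linr (F a)).
Qed.

Lemma conv_linl G : linear (conv^~ G).
Proof.
move=> e F H; apply: funext => s; rewrite -[RHS]/(e *: conv F G s + conv H G s).
by rewrite /conv -split_sum_linear; apply: eq_split_sum => a b _ _; rewrite -(pmul_linl (G b)).
Qed.

Lemma tau_lin : linear tau.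
Proof.
move=> e F G; apply: funext => s.
by rewrite -[RHS]/(e *: tau F s + tau G s) /tau scalerDr !scalerA mulrC.
Qed.

Lemma tauK F : tau (tau F) = F.
Proof.
by apply: funext => s; rewrite /tau scalerA -signr_addb addbb scale1r.
Qed.

Lemma tau_conv F G : tau (conv F G) = conv (tau F) (tau G).
Proof.
apply: funext => s; rewrite /tau /conv split_sumZ; apply: eq_split_sum => a b _ <-.
rewrite (linZ (pmul_linl _)) (linZ (pmul_linr _)) scalerA -signr_addb.
by [].
Qed.

Lemma tau_unitw : tau unitw = unitw.
Proof. by apply: funext => -[|x s]; rewrite /tau /= ?scale1r ?scaler0. Qed.

Lemma conv_unit_r F : conv F unitw = F.
Proof.
apply: funext => s; rewrite /conv split_sum_nil_r => [|a [|x b] //= _].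
  by rewrite pmul1r.
by rewrite (lin0 (pmul_linr _)).
Qed.

(** Graded commutativity of the convolution. The function F is odd, so moving
    it past the letters of the word of G costs the sign tau. *)
Lemma conv_odd_even F G : (forall s, phomog (~~ spar s) (F s)) -> evenw G ->
  conv F (tau G) = conv G F.
Proof.
move=> hF hG; apply: funext => s; rewrite /conv [RHS]split_sum_flip.
apply: eq_split_sum => a b _ _; rewrite /tau (linZ (pmul_linr _)) (pmulC (hF a) (hG b)).
by rewrite scalerA -signr_addb; congr (_ ^+ _ *: _); case: (spar a) (spar b) => [] [].
Qed.

Definition dw x F : C := fun s => F (x :: s).

Lemma conv_cons F G x s :
  conv F G (x :: s) = conv (dw x F) G s + conv (iter (par x) tau F) (dw x G) s.
Proof.
rewrite /conv /=; congr (_ + _); apply: eq_split_sum => a b _ _.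
by case: (par x); rewrite /tau /= ?scale1r // (linZ (pmul_linl _)).
Qed.

Lemma dw_tau F x : dw x (tau F) = (-1) ^+ par x *: tau (dw x F).
Proof.
apply: funext => s; rewrite -[RHS]/(_ *: (_ *: F (x :: s))).
by rewrite scalerA -signr_addb.
Qed.

Section Derivation.
Variables (ldiff : X -> X) (ldiff_par : forall x, par (ldiff x) = ~~ par x).

(** The signed sum over the letters of s of the values of F with the operator
    ldiff applied to that letter. *)
Fixpoint nabla F s : ps :=
  if s is x :: s' then F (ldiff x :: s') + (-1) ^+ par x *: nabla (dw x F) s' else 0.

Lemma nabla_cons F x : dw x (nabla F) = dw (ldiff x) F + (-1) ^+ par x *: nabla (dw x F).
Proof. by []. Qed.

Lemma nabla_lin : linear nabla.
Proof.
move=> e F G; apply: funext => s; rewrite -[RHS]/(e *: nabla F s + nabla G s).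
elim: s F G => [|x s IH] F G /=; first by rewrite scaler0 addr0.
rewrite -[(e *: F + G) _]/(e *: F _ + G _) -[dw x _]/(e *: dw x F + dw x G) IH.
by rewrite !scalerDr !scalerA addrACA mulrC.
Qed.

Lemma nabla_tau F : nabla (tau F) = - tau (nabla F).
Proof.
apply: funext => s; rewrite -[RHS]/(- (_ *: nabla F s)).
elim: s F => [|x s IH] F /=; first by rewrite scaler0 oppr0.
rewrite dw_tau (linZ nabla_lin) -[(_ *: nabla _) s]/(_ *: nabla _ s) IH {1}/tau /= ldiff_par.
rewrite addNb signrN scaleNr scalerDr opprD; congr (_ + _).
rewrite !scalerN !scalerA -!signr_addb; congr (- (_ ^+ _ *: _)).
by case: (par x) (spar s) => [] [].
Qed.

(** Induction on the word: both sides satisfy the recursion given by the first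
    letter, which goes to F or to G. *)
Lemma nabla_conv F G : nabla (conv F G) = conv (nabla F) G + conv (tau F) (nabla G).
Proof.
apply: funext => s; rewrite -[RHS]/(conv (nabla F) G s + conv (tau F) (nabla G) s).
elim: s F G => [|x s IH] F G /=.
  by rewrite /conv /= (lin0 (pmul_linl _)) (lin0 (pmul_linr _)) addr0.
have -> : dw x (conv F G) = conv (dw x F) G + conv (iter (par x) tau F) (dw x G).
  by apply: funext => t; apply: conv_cons.
rewrite (linD nabla_lin) -[(nabla _ + nabla _) s]/(nabla _ s + nabla _ s) !IH.
rewrite !conv_cons !nabla_cons dw_tau ldiff_par.
have cl H H' K : conv (H + (-1) ^+ par x *: H') K s =
    conv H K s + (-1) ^+ par x *: conv H' K s.
  by rewrite (linD (conv_linl _)) (linZ (conv_linl _)).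
have cr H H' K : conv K (H + (-1) ^+ par x *: H') s =
    conv K H s + (-1) ^+ par x *: conv K H' s.
  by rewrite (linD (conv_linr _)) (linZ (conv_linr _)).
have cz H K : conv ((-1) ^+ par x *: H) K s = (-1) ^+ par x *: conv H K s.
  by rewrite (linZ (conv_linl _)).
have itN : iter (par x) tau (tau F) = iter (~~ par x) tau F.
  by case: (par x); rewrite //= tauK.
have nit : conv (nabla (iter (par x) tau F)) (dw x G) s =
    (-1) ^+ par x *: conv (iter (par x) tau (nabla F)) (dw x G) s.
  case: (par x); rewrite /= ?scale1r // nabla_tau -scaleN1r.
  by rewrite (linZ (conv_linl _)).
rewrite cl cr cz itN nit !scalerDr scalerA -signr_addb addbb scale1r.
have -> : tau (iter (par x) tau F) = iter (~~ par x) tau F.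
  by case: (par x); rewrite //= tauK.
rewrite -!addrA; congr (_ + _); rewrite [LHS]addrCA; congr (_ + _).
rewrite [LHS]addrCA [RHS]addrCA; congr (_ + _).
by rewrite [LHS]addrCA.
Qed.
End Derivation.

(** * Exponentials *)

Definition vanish n F := forall s, (size s < n)%N -> F s = 0.

Section Conjugation.
Variable g : C.
Hypothesis g0 : g [::] = 0.
Notation L := (conv g).

(** As g vanishes on the empty word, convolution with g raises by one the length
    up to which a function vanishes. This makes all exponentials of g finite
    sums at each word. *)
Lemma vanish_conv n F : vanish n F -> vanish n.+1 (L F).
Proof.
move=> hF s hs; apply: split_sum0 => -[|x a] b /= hab.
  by rewrite g0 (lin0 (pmul_linl _)).
by rewrite hF ?(lin0 (pmul_linr _)) //; lia.
Qed.

Lemma vanish_iter n m F : vanish n F -> vanish (m + n) (iter m L F).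
Proof. by move=> hF; elim: m => //= m; apply: vanish_conv. Qed.

Lemma iter_lin m : linear (iter m L).
Proof. by move=> e F G; elim: m => //= m ->; rewrite conv_linr. Qed.

(** The r-fold commutator of P with convolution by g. *)
Fixpoint iter_ad (P : C -> C) r (F : C) : C :=
  if r is r'.+1 then iter_ad P r' (L F) - L (iter_ad P r' F) else P F.

Arguments iter_ad : simpl never.

Lemma iter_adS P r F : iter_ad P r.+1 F = iter_ad P r (L F) - L (iter_ad P r F).
Proof. by []. Qed.

Lemma vanish_iter_ad P r n F : (forall n F, vanish n F -> vanish n (P F)) ->
  vanish n F -> vanish (r + n) (iter_ad P r F).
Proof.
move=> hP; elim: r n F => [|r IH] n F hF; first exact: hP.
move=> s hs; rewrite -[LHS]/(iter_ad P r (L F) s - L (iter_ad P r F) s).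
rewrite (IH _ _ (vanish_conv hF)) ?(vanish_conv (IH _ _ hF)) ?subrr //.
by rewrite addnS.
Qed.

Lemma iter_ad_iter P j m F : linear P ->
  iter_ad P j (iter m L F) =
    \sum_(r < m.+1) iter (m - r) L (iter_ad P (j + r) F) *+ 'C(m, r).
Proof.
move=> Pl; elim: m j => [|m IH] j; first by rewrite big_ord1 addn0 bin0.
have -> : iter_ad P j (iter m.+1 L F) =
    L (iter_ad P j (iter m L F)) + iter_ad P j.+1 (iter m L F).
  by rewrite iter_adS addrC subrK.
rewrite !IH (lin_sum (conv_linr _)) big_ord_recl [RHS]big_ord_recl !bin0 -addrA.
rewrite subn0; congr (_ + _).
rewrite [X in _ + X]big_ord_recr [RHS]big_ord_recr !binn !subnn addrA.
congr (_ + _); last by rewrite addnS.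
rewrite -big_split; apply: eq_bigr => i _.
rewrite -[lift ord0 _ : nat]/(i.+1) -[_ (widen_ord _ i) : nat]/(i : nat).
rewrite binS mulrnDr subSS addnS addSn; congr (_ + _).
rewrite -!scaler_nat (linZ (conv_linr _)) -iterS subnSK //.
Qed.

End Conjugation.
End Convolution.

Lemma sum_triangle (V : nmodType) (F : nat -> nat -> V) N :
    (forall i j, (N <= i + j)%N -> F i j = 0) ->
  \sum_(m < N) \sum_(i < m.+1) F i (m - i)%N = \sum_(i < N) \sum_(j < N) F i j.
Proof.
move=> F0.
under eq_bigr => m _ do rewrite -(sum_antidiagonal F (ltn_ord m)).
rewrite exchange_big; apply: eq_bigr => i _ /=.
rewrite (exchange_big_dep xpredT) //=; apply: eq_bigr => j _.
case: (ltnP (i + j) N) => ij; last by rewrite F0 // big1.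
by rewrite (big_pred1 (Ordinal ij)) // => m; rewrite eq_sym.
Qed.

Section Exponential.
Variables (k : fieldType) (A : scomalg k) (X : Type) (par : X -> bool).
Hypothesis k_char0 : [pchar k] =i pred0.
Notation ps := (nat -> A).
Notation C := (seq X -> nat -> A).
Notation spar := (spar par).
Notation split_sum := (split_sum par).
Notation conv := (@conv k A X par).
Notation tau := (@tau k A X par).
Notation unitw := (@unitw k A X).
Notation vanish := (@vanish k A X).
Notation iter_ad := (@iter_ad k A X par).
Implicit Types (s a b c : seq X) (x y z : X) (F G H u : C).

Lemma factV_neq0 n : n`!%:R != 0 :> k.
Proof. by rewrite ((pcharf0P k).1 k_char0) -lt0n fact_gt0. Qed.

Lemma bin_factV m r : (r <= m)%N ->
  (m`!%:R)^-1 * 'C(m, r)%:R = ((m - r)`!%:R)^-1 * (r`!%:R)^-1 :> k.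
Proof.
move=> rm; have := congr1 (fun n => n%:R : k) (bin_fact rm); rewrite !natrM.
move: (factV_neq0 m) (factV_neq0 r) (factV_neq0 (m - r)).
move: (m`!%:R : k) (r`!%:R : k) ((m - r)`!%:R : k) ('C(m, r)%:R : k) => a b c d.
move=> a0 b0 c0 e; rewrite -e -invfM [c * b]mulrC.
have bc0 : b * c != 0 by rewrite mulf_neq0.
have d0 : d != 0 by apply: contraNneq a0 => d0; rewrite -e d0 mul0r.
by rewrite invfM mulrAC mulVf ?mul1r.
Qed.

Variable g : C.
Hypothesis g0 : g [::] = 0.
Notation L := (conv g).

(** The exponential of g, truncated; on words shorter than N the omitted terms
    vanish. *)
Definition exp_conv N : C := \sum_(m < N) (m`!%:R)^-1 *: iter m L unitw.
(** The value at the unit of e^(-g) P e^g, by the adjoint action formula. *)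
Definition exp_ad P N : C := \sum_(r < N) (r`!%:R)^-1 *: iter_ad g P r unitw.

(** P e^g = e^g (e^(-g) P e^g), from the expansion of P g^m into commutators. *)
Lemma exp_ad_expansion P N s : linear P ->
    (forall n F, vanish n F -> vanish n (P F)) -> (size s < N)%N ->
  P (exp_conv N) s = \sum_(j < N) (j`!%:R)^-1 *: iter j L (exp_ad P N) s.
Proof.
move=> Pl Ploc sN.
pose w j r := (j`!%:R)^-1 *: ((r`!%:R)^-1 *: iter j L (iter_ad g P r unitw) s) : ps.
transitivity (\sum_(i < N) \sum_(j < N) w i j); last first.
  apply: eq_bigr => i _; rewrite -scaler_sumr; congr (_ *: _).
  rewrite /exp_ad (lin_sum (iter_lin _ _ _)) sum_fctE; apply: eq_bigr => j _.
  by rewrite (linZ (iter_lin _ _ _)).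
rewrite exchange_big -(@sum_triangle _ (fun j i => w i j)); last first.
  move=> r j hjr; rewrite /w (@vanish_iter _ _ _ par g g0 r) ?scaler0 //.
    have h := @vanish_iter_ad _ _ _ par g g0 P r 0 unitw Ploc.
    by rewrite addn0 in h; apply: h.
  by rewrite addnC (leq_trans sN).
rewrite /exp_conv (lin_sum Pl) sum_fctE; apply: eq_bigr => m _.
rewrite (linZ Pl) -[LHS]/(_ *: P _ s) -[P]/(iter_ad g P 0) iter_ad_iter //.
rewrite sum_fctE scaler_sumr; apply: eq_bigr => r _; rewrite add0n.
rewrite -scaler_nat -[(_ *: _) s]/(_ *: (iter _ _ _ s)) /w !scalerA; congr (_ *: _).
by rewrite bin_factV // -ltnS.
Qed.

(** If P e^g vanishes on the words shorter than s, then so does e^(-g) P e^g, as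
    e^g is invertible; at s the two differ by terms that involve its values on
    shorter words only. *)
Lemma exp_ad_leading P N s : linear P ->
    (forall n F, vanish n F -> vanish n (P F)) -> (size s < N)%N ->
    vanish (size s) (P (exp_conv N)) ->
  P (exp_conv N) s = exp_ad P N s.
Proof.
move=> Pl Ploc; move: {2}(size s).+1 (ltnSn (size s)) => n.
elim: n s => // n IH s sn sN hs; rewrite exp_ad_expansion //.
case: N IH hs sN => // N IH hs sN; rewrite big_ord_recl /= invr1 scale1r.
rewrite big1 ?addr0 // => i _; rewrite -[L (iter _ _ _)]/(iter i.+1 L _).
rewrite (@vanish_iter _ _ _ par g g0 (size s)) ?scaler0 //; last by rewrite addSn ltnS leq_addl.
move=> t ts; rewrite -IH ?hs //; first exact: leq_trans ts _.
  exact: ltn_trans ts sN.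
by move=> t' t't; apply: hs; apply: ltn_trans t't ts.
Qed.

Section TauNabla.
Variables (ldiff : X -> X) (ldiff_par : forall x, par (ldiff x) = ~~ par x).
Notation nabla := (@nabla k A X par ldiff).
Hypothesis g_even : evenw par g.

Definition tnabla F := tau (nabla F).

Lemma tnabla_lin : linear tnabla.
Proof. by move=> e F G; rewrite /tnabla nabla_lin tau_lin. Qed.

Lemma nabla_homog (c : bool) F :
    (forall s, phomog (c (+) spar s) (F s)) ->
  forall s, phomog (~~ (c (+) spar s)) (nabla F s).
Proof.
move=> hF s; elim: s c F hF => [|x s IH] c F hF /=; first by move=> n; apply: homog0.
move=> n; apply: homogD.
  by have := hF (ldiff x :: s) n; rewrite /= ldiff_par addNb addbN.
apply: homogZ; rewrite addbA; apply: IH => t.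
by have := hF (x :: t); rewrite /= addbA.
Qed.

Lemma vanish_nabla n F : vanish n F -> vanish n (nabla F).
Proof.
move=> hF s; elim: s n F hF => [|x s IH] [|n] F hF //= hs.
by rewrite hF // (IH n) ?scaler0 ?addr0 // => t ht; apply: hF.
Qed.

Lemma vanish_tau n F : vanish n F -> vanish n (tau F).
Proof. by move=> hF s hs; rewrite /tau hF // scaler0. Qed.

Lemma vanish_tnabla n F : vanish n F -> vanish n (tnabla F).
Proof. by move=> /vanish_nabla /vanish_tau. Qed.

Lemma nabla_unitw : nabla unitw = 0.
Proof.
have nabla0 : nabla 0 = 0 by apply: (lin0 (nabla_lin _ _)).
apply: funext => -[|x s] //=; rewrite -[dw x _]/(0 : C) nabla0 scaler0 addr0 //.
Qed.

Lemma iter_ad_tnabla1 F : iter_ad g tnabla 1 F = conv (tnabla g) (tau F).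
Proof.
rewrite iter_adS /iter_ad /= /tnabla nabla_conv // (linD (tau_lin _)) !tau_conv tauK.
by rewrite addrK.
Qed.

(** nabla is a derivation, so its commutator with convolution by g is convolution
    by nabla g, which commutes with g. *)
Lemma iter_ad_tnabla2 r F : iter_ad g tnabla r.+2 F = 0.
Proof.
elim: r F => [|r IH] F; rewrite iter_adS; last by rewrite !IH (lin0 (conv_linr _ _)) subrr.
have e : conv (tnabla g) (tau g) = conv g (tnabla g); last first.
  by rewrite !iter_ad_tnabla1 tau_conv !convA e subrr.
apply: conv_odd_even => // s n; rewrite /tnabla /tau; apply: homogZ.
exact: (@nabla_homog false _ g_even).
Qed.

Lemma exp_ad_tnabla N : exp_ad tnabla N.+2 = tnabla g.
Proof.
rewrite /exp_ad !big_ord_recl big1 => [|r _]; last by rewrite iter_ad_tnabla2 scaler0.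
rewrite addr0 iter_ad_tnabla1 tau_unitw conv_unit_r {1}/iter_ad /= /tnabla nabla_unitw.
by rewrite (lin0 (tau_lin _)) scaler0 add0r invr1 scale1r.
Qed.

End TauNabla.

Section TauD.
Variable Q : nat -> A -> A.
Hypotheses (Qlin : forall i, linear (Q i)) (Qodd : forall i, op_parity true (Q i)).
Hypothesis g_even : evenw par g.

Definition tD F : C := tau (fun s => serop Q (F s)).

(** The r-fold commutator of Q with multiplication by g, as a function on words
    with values in series of operators: by [iter_ad_tD], convolution with it is
    the r-fold commutator of tD with convolution by g. *)
Fixpoint iter_bracket r : seq X -> nat -> A -> A :=
  if r is r'.+1 then fun s => split_sum s (fun a b => pbracket (iter_bracket r' a) (g b))
  else fun s => if s is [::] then Q else 0.

Lemma tD_lin : linear tD.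
Proof.
move=> e F G; rewrite /tD -tau_lin; congr tau.
by apply: funext => s; rewrite (serop_lin Qlin).
Qed.

Lemma vanish_tD n F : vanish n F -> vanish n (tD F).
Proof.
move=> hF; apply: vanish_tau => s hs; rewrite hF //; exact: (lin0 (serop_lin Qlin)).
Qed.

Lemma iter_bracket_lin r s i : linear (iter_bracket r s i).
Proof.
have lin0f n : linear ((0 : nat -> A -> A) n).
  by move=> e x y; rewrite -[LHS]/(0 : A) -[RHS]/(e *: 0 + 0 : A) scaler0 addr0.
elim: r s i => [|r IH] s /=; first by case: s => [|x s] i; [apply: Qlin | apply: lin0f].
apply: (@split_sum_closed k X par _ (fun f : nat -> A -> A => forall i, linear (f i))) => //.
  move=> e f1 f2 h1 h2 i c x y; rewrite -![(e *: f1 + f2) i _]/(e *: f1 i _ + f2 i _).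
  by rewrite h1 h2 !scalerDr !scalerA addrACA mulrC.
by move=> a b _ _ i; apply: pbracket_lin; apply: IH.
Qed.

Lemma iter_bracket_op_parity r s i : op_parity (true (+) spar s) (iter_bracket r s i).
Proof.
have hom0f (c : bool) n : op_parity c ((0 : nat -> A -> A) n) by move=> b x _; apply: homog0.
elim: r s i => [|r IH] s; first by case: s => [|x s] i; [apply: Qodd | apply: hom0f].
apply: (@split_sum_closed k X par _
  (fun f : nat -> A -> A => forall i, op_parity (~~ spar s) (f i))) => //.
  by move=> e f1 f2 h1 h2 i b x hx; apply: homog_lin; [apply: h1|apply: h2].
move=> a b _ hp i; rewrite -[~~ spar s]/(true (+) spar s) -hp addbA.
apply: pbracket_op_parity => // j; exact: iter_bracket_lin.
Qed.

Lemma iter_ad_tD r F s :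
  iter_ad g tD r F s =
    (-1) ^+ spar s *: split_sum s (fun a b => serop (iter_bracket r a) (F b)).
Proof.
elim: r F s => [|r IH] F s.
  rewrite /iter_ad /= /tD /tau split_sum_nil_l //= => -[|x a] b //= _.
  by apply: funext => n; rewrite /serop big1.
rewrite iter_adS -[LHS]/(iter_ad g tD r (L F) s - L (iter_ad g tD r F) s) IH.
have -> : L (iter_ad g tD r F) s = (-1) ^+ spar s *:
   split_sum s (fun a e => split_sum e (fun b c => (-1) ^+ ((true (+) spar a) && spar b) *:
       pmul (g b) (serop (iter_bracket r a) (F c)))).
  rewrite split_sum_swap /conv split_sumZ; apply: eq_split_sum => b e _ hp; rewrite IH.
  rewrite (linZ (pmul_linr _)) (split_sum_lin _ _ _ (pmul_linr _)) !split_sumZ.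
  apply: eq_split_sum => a c _ he; rewrite !scalerA -!signr_addb; congr (_ ^+ _ *: _).
  by rewrite -hp; case: (spar a) (spar b) (spar e) => [] [] [].
rewrite -scalerBr -split_sumB; congr (_ *: _).
rewrite (eq_split_sum (G := fun a e => split_sum e (fun b c =>
    serop (pbracket (iter_bracket r a) (g b)) (F c)))); last first.
  move=> a e _ _; rewrite (split_sum_lin _ _ _ (serop_lin (iter_bracket_lin r a))) -split_sumB.
  apply: eq_split_sum => b c _ _.
  have hb := iter_bracket_op_parity r a.
  by rewrite (pbracketE _ (iter_bracket_lin r a) hb (g_even b)).
rewrite split_sum_assoc; apply: eq_split_sum => e c _ _ /=.
rewrite -(split_sum_lin par e (P := fun f => serop f (F c))) // => d f1 f2.
apply: funext => n; rewrite -[RHS]/(d *: serop f1 (F c) n + serop f2 (F c) n).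
by rewrite /serop scaler_sumr -big_split.
Qed.

Lemma exp_ad_tD N s n :
  exp_ad tD N s n = (-1) ^+ spar s *: \sum_(r < N) (r`!%:R)^-1 *: iter_bracket r s n (sone A).
Proof.
rewrite /exp_ad sum_fctE sum_fctE scaler_sumr; apply: eq_bigr => r _.
rewrite -[LHS]/(_ *: iter_ad g tD r unitw s n) iter_ad_tD split_sum_nil_r => [|a [|x b] //= _].
  rewrite -[(_ *: _) n]/(_ *: serop _ _ n) serop_const_series; last exact: iter_bracket_lin.
  by rewrite !scalerA mulrC.
by rewrite (lin0 (serop_lin (iter_bracket_lin r a))).
Qed.

End TauD.
End Exponential.

(** * Differential operators and leading coefficients *)

Section Order.
Variables (k : fieldType) (A : BVinfty k) (X : Type) (par : X -> bool).
Notation C := (seq X -> nat -> A).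
Notation split_sum := (split_sum par).
Notation bv_ops := (@bv_ops k A).
Implicit Types (s a b : seq X).

Lemma scomm_order m (P : A -> A) (a : A) :
  in_Fpred m P -> in_Fpred m.-1 (scomm P (smul a)).
Proof.
case: m => [|m] //= P0; have -> : P = 0 by apply: funext.
by move=> x; rewrite scomm0 //; apply: smul_lin_r.
Qed.

Lemma scomm_mul0 (P : A -> A) : linear P -> scomm P (smul 0) = 0.
Proof.
move=> Pl; have := scomm_linr (-1) 0 0 Pl.
by rewrite scaler0 addr0 scaleN1r addNr.
Qed.

Variable g : C.
Hypotheses (g0 : g [::] = 0) (g_div : forall s, vanish_below (size s).-1 (g s)).
Notation iter_bracket := (@iter_bracket k A X par g bv_ops).

(** The coefficient of h^n in D has order n + 1. A commutator with the
    coefficient of h^j in g(b) lowers the order by one and raises the exponent of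
    h by j, and j is at least the length of b minus 1. Hence each letter of s
    lowers the bound by one. *)
Lemma iter_bracket_order r s n : in_Fpred (n + 2 - size s)%N (iter_bracket r s n).
Proof.
elim: r s n => [|r IH] s n /=.
  case: s => [|x s]; last exact: in_Fpred0.
  by rewrite subn0 addn2; apply: bvD_order.
apply: (@split_sum_closed k X par _
  (fun f : nat -> A -> A => in_Fpred (n + 2 - size s)%N (f n))).
- by move=> e f1 f2; apply: in_Fpred_lin.
- exact: in_Fpred0.
move=> a b hs _; apply: in_Fpred_sum => i _.
have [hb|hb] := ltnP (n - i)%N (size b).-1.
  by rewrite g_div // scomm_mul0; [apply: in_Fpred0|apply: iter_bracket_lin => j; apply: bv_ops_lin].
case: b hs hb => [|x b] /= hs hb.
  rewrite g0 scomm_mul0; [apply: in_Fpred0|apply: iter_bracket_lin => j; apply: bv_ops_lin].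
apply: in_Fpred_mono (scomm_order _ (IH a i)).
by have := ltn_ord i; lia.
Qed.

(** The components of the L-infinity map: the lowest coefficient of g(s) that can
    be nonzero. *)
Definition lead_val s : A := g s (size s).-1.

(** The contribution to [iter_bracket] of the coefficient of h^i in the operator
    and of the lowest coefficients of g. *)
Fixpoint lead_bracket i r : seq X -> A -> A :=
  if r is r'.+1 then
    fun s => split_sum s (fun a b => scomm (lead_bracket i r' a) (smul (lead_val b)))
  else fun s => if s is [::] then bv_ops i else 0.

Lemma lead_bracket_lin i r s : linear (lead_bracket i r s).
Proof.
have lin0f : linear (0 : A -> A).
  by move=> e x y; rewrite -[LHS]/(0 : A) -[RHS]/(e *: 0 + 0 : A) scaler0 addr0.
elim: r s => [|r IH] s /=; first by case: s => [|x s]; [apply: bv_ops_lin | apply: lin0f].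
apply: (@split_sum_closed k X par _ (fun f : A -> A => linear f)) => //.
  move=> e f1 f2 h1 h2 c x y; rewrite -![(e *: f1 + f2) _]/(e *: f1 _ + f2 _).
  by rewrite h1 h2 !scalerDr !scalerA addrACA mulrC.
by move=> a b _ _; apply: scomm_lin; apply: IH.
Qed.

Lemma lead_bracket_order i r s : in_Fpred (i + 2 - r)%N (lead_bracket i r s).
Proof.
elim: r s => [|r IH] s /=.
  case: s => [|x s]; last exact: in_Fpred0.
  by rewrite subn0 addn2; apply: bvD_order.
apply: (@split_sum_closed k X par _ (in_Fpred (i + 2 - r.+1)%N)).
- by move=> e f1 f2; apply: in_Fpred_lin.
- exact: in_Fpred0.
by move=> a b _ _; rewrite subnS; apply: scomm_order.
Qed.

(** In the count of [iter_bracket_order], every unit by which the exponent of a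
    coefficient of g exceeds its minimum, the total exponent being fixed, takes
    a lower coefficient of D and so lowers the order by one more. *)
Lemma iter_bracket_lead i r s n : (n + r = size s + i)%N ->
  in_Fpred (i + 1 - r)%N (iter_bracket r s n - lead_bracket i r s).
Proof.
have bl j a m : linear (iter_bracket j a m) by apply: iter_bracket_lin => l; apply: bv_ops_lin.
elim: r s n => [|r IH] s n hn /=.
  case: s hn => [|x s] hn; last by rewrite subrr; apply: in_Fpred0.
  have -> : n = i by move: hn => /=; lia.
  by rewrite subrr; apply: in_Fpred0.
have -> : split_sum s (fun a b => pbracket (iter_bracket r a) (g b)) n =
    split_sum s (fun a b => pbracket (iter_bracket r a) (g b) n).
  by rewrite (split_sum_lin par s (P := fun f : nat -> A -> A => f n)).
rewrite -split_sumB; apply: (@split_sum_closed k X par _ (in_Fpred (i + 1 - r.+1)%N)).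
- by move=> e f1 f2; apply: in_Fpred_lin.
- exact: in_Fpred0.
move=> a [|x b] hs _.
  rewrite /lead_val g0 scomm_mul0; last exact: lead_bracket_lin.
  rewrite /pbracket big1 ?subrr; first exact: in_Fpred0.
  by move=> j _; rewrite scomm_mul0.
have hs' : (size a + (size b).+1)%N = size s by [].
have [hb|hb] := ltnP n (size b).
  rewrite /pbracket big1 => [|j _]; last first.
    rewrite g_div ?scomm_mul0 //=; exact: leq_ltn_trans (leq_subr _ _) hb.
  rewrite sub0r -scaleN1r -[_ *: _]addr0; apply: in_Fpred_lin; last exact: in_Fpred0.
  apply: in_Fpred_mono (scomm_order _ (lead_bracket_order i r a)); lia.
have jn : (n - size b < n.+1)%N by rewrite ltnS leq_subr.
rewrite /pbracket (bigD1 (Ordinal jn)) //= addrAC subKn //.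
have -> : scomm (iter_bracket r a (n - size b)%N) (smul (g (x :: b) (size b))) -
    scomm (lead_bracket i r a) (smul (lead_val (x :: b))) =
  scomm (iter_bracket r a (n - size b)%N - lead_bracket i r a) (smul (lead_val (x :: b))).
  rewrite addrC -scaleN1r -scomm_linl; last exact: smul_lin_r.
  by rewrite scaleN1r addrC.
rewrite -[X in in_Fpred _ (X + _)]scale1r; apply: in_Fpred_lin.
  rewrite addn1 subSS -[X in in_Fpred X](_ : (i + 1 - r).-1 = _)%N; last by lia.
  by apply: scomm_order; apply: IH; lia.
apply: in_Fpred_sum => j jneq.
have [hj|hj] := ltnP (n - j)%N (size b).
  by rewrite g_div //= scomm_mul0 //; apply: in_Fpred0.
apply: in_Fpred_mono (scomm_order _ (iter_bracket_order r a j)).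
have : (j != n - size b :> nat)%N by apply: contraNneq jneq => e; apply/eqP/val_inj.
by have := ltn_ord j; lia.
Qed.

(** For i + 1 = r the error term of [iter_bracket_lead] has negative order. *)
Lemma iter_bracket_top r s : s <> [::] ->
  iter_bracket r.+1 s (size s).-1 = lead_bracket r r.+1 s.
Proof.
move=> s0; have /= h := @iter_bracket_lead r r.+1 s (size s).-1.
apply: funext => x; apply/eqP; rewrite -subr_eq0; apply/eqP.
have -> : iter_bracket r.+1 s (size s).-1 x - lead_bracket r r.+1 s x =
    (iter_bracket r.+1 s (size s).-1 - lead_bracket r r.+1 s) x by [].
have : in_Fpred (r + 1 - r.+1)%N
    (iter_bracket r.+1 s (size s).-1 - lead_bracket r r.+1 s).
  by apply: h; case: s s0 => //= y s _; lia.
by rewrite addn1 subnn.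
Qed.

Lemma iter_bracket_vanish_below r s n x : (n < (size s).-1)%N -> iter_bracket r s n x = 0.
Proof.
by move=> hn; have := iter_bracket_order r s n; have -> : (n + 2 - size s = 0)%N by lia.
Qed.

End Order.

(** * Regular functions on words *)

Section Regular.
Variables (k : fieldType) (A : scomalg k) (X : Type) (par : X -> bool).
Variable R : X -> k -> X -> X -> Prop.
Hypothesis R_par : forall z e x y, R z e x y -> par x = par z /\ par y = par z.
Notation ps := (nat -> A).
Notation C := (seq X -> nat -> A).
Notation spar := (spar par).
Notation split_sum := (split_sum par).
Notation conv := (@conv k A X par).
Notation unitw := (@unitw k A X).
Implicit Types (s a b c : seq X) (x y z : X) (F G H g u : C).

Definition regular F := [/\ evenw par F, sym_words par F & slot_lin R F].

Lemma regular_lin e F G : regular F -> regular G -> regular (e *: F + G).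
Proof.
move=> [F1 F2 F3] [G1 G2 G3]; split=> [s n|s1 s2 x y|s1 s2 z c x y Rz].
- by apply: homog_lin; [apply: F1|apply: G1].
- rewrite -![(e *: F + G) _]/(e *: F _ + G _) F2 G2 scalerDr !scalerA.
  by rewrite [e * _]mulrC.
- rewrite -![(e *: F + G) _]/(e *: F _ + G _) (F3 _ _ _ _ _ _ Rz) (G3 _ _ _ _ _ _ Rz).
  by rewrite !scalerDr !scalerA addrACA [e * _]mulrC.
Qed.

Lemma regular0 : regular 0.
Proof.
split=> [s n|s1 s2 x y|s1 s2 z c x y Rz]; first exact: homog0.
  by rewrite -[LHS]/(0 : ps) -[RHS]/(_ *: (0 : ps)) scaler0.
by rewrite -[LHS]/(0 : ps) -[RHS]/(c *: (0 : ps) + 0) scaler0 addr0.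
Qed.

Lemma regularD F G : regular F -> regular G -> regular (F + G).
Proof. by move=> hF hG; rewrite -[F]scale1r; apply: regular_lin. Qed.

Lemma regularZ e F : regular F -> regular (e *: F).
Proof. by move=> hF; rewrite -[_ *: F]addr0; apply: regular_lin => //; apply: regular0. Qed.

Lemma regular_sum I (r : seq I) (P : pred I) (F : I -> C) :
  (forall i, P i -> regular (F i)) -> regular (\sum_(i <- r | P i) F i).
Proof.
by move=> hF; elim/big_ind: _ => //; [apply: regular0|apply: regularD].
Qed.

(** Let 1 = e + o be the decomposition into parities. Comparing parities in
    e 1 = e gives e o = 0, and in o 1 = o it gives o = o e, so o = 0 by
    commutativity. *)
Lemma sone_even : homog false (sone A).
Proof.
have [he ho] := (homog_spr false (sone A), homog_spr true (sone A)).
have := sum_spr (sone A); rewrite big_bool /=.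
set e := spr A false _ in he *; set o := spr A true _ in ho * => oe.
have eo0 : smul e o = 0.
  have := congr1 (spr A true) (smulx1 e); rewrite -oe (linD (smul_lin_r e)) linearD.
  rewrite (spr_homog _ (smul_homog he ho)) (spr_homog _ (smul_homog he he)).
  by rewrite (spr_homog _ he) /= addr0.
have o0 : o = 0.
  have := congr1 (spr A true) (smulx1 o); rewrite -oe (linD (smul_lin_r o)) linearD.
  rewrite (spr_homog _ (smul_homog ho ho)) (spr_homog _ (smul_homog ho he)) /=.
  by rewrite add0r (smulC ho he) eo0 scaler0 (spr_homog _ ho).
by rewrite -oe o0 add0r.
Qed.

Lemma regular_unitw : regular unitw.
Proof.
split=> [[|x s] n|[|w s1] s2 x y|[|w s1] s2 z e x y Rz] /=;
  rewrite ?scaler0 ?addr0 //; last exact: homog0.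
case: n => [|n] /=; last exact: homog0.
exact: sone_even.
Qed.

Lemma regular_conv F G : regular F -> regular G -> regular (conv F G).
Proof.
move=> [F1 F2 F3] [G1 G2 G3]; split=> [s n|s1 s2 x y|s1 s2 z e x y Rz].
- apply: (@split_sum_closed k X par _ (fun f : ps => homog (spar s) (f n))).
  + by move=> e f1 f2; apply: homog_lin.
  + exact: homog0.
  + by move=> a b _ <-; apply: pmul_homog.
- apply: split_sum_sym => [b|a] t1 t2 u v.
    by rewrite F2 (linZ (pmul_linl _)).
  by rewrite G2 (linZ (pmul_linr _)).
- apply: (split_sum_slot_lin _ _ _ _ _ Rz) => // [b|a] t1 t2 z' e' x' y' R'.
    by rewrite (F3 _ _ _ _ _ _ R') (pmul_linl _).
  by rewrite (G3 _ _ _ _ _ _ R') (pmul_linr _).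
Qed.

Lemma regular_iter_conv g m : regular g -> regular (iter m (conv g) unitw).
Proof.
by move=> hg; elim: m => [|m IH] /=; [apply: regular_unitw|apply: regular_conv].
Qed.

Lemma regular_comp (f : ps -> ps) F :
    linear f -> (forall (b : bool) (u : ps), phomog b u -> phomog b (f u)) ->
    regular F ->
  regular (fun s => f (F s)).
Proof.
move=> fl fe [F1 F2 F3]; split=> [s|s1 s2 x y|s1 s2 z e x y Rz].
- exact: fe.
- by rewrite F2 (linZ fl).
- by rewrite (F3 _ _ _ _ _ _ Rz) fl.
Qed.

Lemma size_slot (T : Type) (s1 s2 : seq T) (x y : T) :
  size (s1 ++ x :: s2) = size (s1 ++ y :: s2).
Proof. by rewrite !size_cat. Qed.

Lemma regular_size (F : nat -> C) :
  (forall n, regular (F n)) -> regular (fun s => F (size s) s).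
Proof.
move=> hF; split=> [s|s1 s2 x y|s1 s2 z e x y Rz].
- by case: (hF (size s)) => h _ _; apply: h.
- have -> : size (s1 ++ x :: y :: s2) = size (s1 ++ y :: x :: s2) by rewrite !size_cat.
  by case: (hF (size (s1 ++ y :: x :: s2))) => _ h _; apply: h.
- rewrite (size_slot _ _ z x) (size_slot _ _ y x).
  by case: (hF (size (s1 ++ x :: s2))) => _ _ h; apply: h.
Qed.

End Regular.

Definition tail (V : nmodType) m (u : nat -> V) : nat -> V :=
  fun n => if (m <= n)%N then u n else 0.

Section Higher.
Variables (k : fieldType) (A : scomalg k) (X : Type) (par : X -> bool).
Notation C := (seq X -> nat -> A).
Notation conv := (@conv k A X par).
Notation unitw := (@unitw k A X).
Implicit Types (s a b c : seq X) (g : C).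

Definition exp_higher M g : C :=
  \sum_(m < M) ((m.+2)`!%:R)^-1 *: iter m.+2 (conv g) unitw.

Lemma exp_conv_higher M g : exp_conv par g M.+2 = unitw + g + exp_higher M g.
Proof.
rewrite /exp_conv !big_ord_recl -addrA; congr (_ + (_ + _)).
- by rewrite invr1 scale1r.
- by rewrite invr1 scale1r /= conv_unit_r.
Qed.

Lemma exp_higher_stable g M s : g [::] = 0 -> (size s < M.+2)%N ->
  exp_higher M g s = exp_higher (size s) g s.
Proof.
move=> g0 sM.
have z m : (size s < m)%N -> (m`!%:R : k)^-1 *: iter m (conv g) unitw s = 0.
  move=> sm; rewrite (@vanish_iter _ _ _ par g g0 0 m) ?scaler0 ?addn0 //.
have w N : (size s < N.+2)%N -> exp_higher N g s =
   \sum_(m < (size s).-1) ((m.+2)`!%:R)^-1 *: iter m.+2 (conv g) unitw s.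
  move=> sN; rewrite /exp_higher sum_fctE.
  rewrite [RHS](big_ord_widen N
    (fun m => ((m.+2)`!%:R)^-1 *: iter m.+2 (conv g) unitw s)); last by lia.
  rewrite [RHS]big_mkcond; apply: eq_bigr => m _; case: ifP => // /negbT hm.
  by rewrite -[LHS]/(_ *: (iter _ _ _ s)) z //; lia.
by rewrite !w // ltnS leqnSn.
Qed.

Definition cut n g : C := fun s => if (0 < size s < n)%N then g s else 0.

(** A product of at least two values of g on nonempty subwords of s involves
    shorter words only. *)
Lemma exp_higher_cut g M s : g [::] = 0 ->
  exp_higher M (cut (size s) g) s = exp_higher M g s.
Proof.
move=> g0; set g' := cut _ g.
have gg' a : (size a < size s)%N -> g' a = g a.
  by case: a => [|x a] h; rewrite /g' /cut ?h ?g0.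
have it m b : (size b < size s)%N -> iter m (conv g') unitw b = iter m (conv g) unitw b.
  elim: m b => // m IH b hb; rewrite /= /conv; apply: eq_split_sum => c d hcd _.
  by rewrite gg' ?IH //; lia.
have g'0 : g' [::] = 0 by [].
rewrite /exp_higher !sum_fctE; apply: eq_bigr => m _; congr (_ *: _).
rewrite -[LHS]/(conv g' (iter m.+1 (conv g') unitw) s).
rewrite -[RHS]/(conv g (iter m.+1 (conv g) unitw) s).
apply: eq_split_sum => a b hab _.
case: a hab => [|x a] hab; first by rewrite g0 g'0 !(lin0 (pmul_linl _)).
case: b hab => [|y b] hab; last first.
  by rewrite gg' ?(it m.+1 (y :: b)) //; rewrite -hab /=; lia.
have z h : h [::] = 0 -> iter m.+1 (conv h) unitw [::] = 0.
  by move=> h0; apply: (@vanish_iter _ _ _ par h h0 0 m.+1) => //; rewrite addn0.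
by rewrite !z // !(lin0 (pmul_linr _)).
Qed.
End Higher.

(** * Construction of the morphism over power series *)

Lemma iter_adB (k : fieldType) (A : scomalg k) (X : Type) (par : X -> bool)
    (g : seq X -> nat -> A) (P1 P2 : (seq X -> nat -> A) -> (seq X -> nat -> A)) r F :
  iter_ad par g (fun u => P1 u - P2 u) r F = iter_ad par g P1 r F - iter_ad par g P2 r F.
Proof.
elim: r F => // r IH F; rewrite !iter_adS !IH (linB (conv_linr _ _)).
by rewrite !opprD !addrA; congr (_ + _); rewrite addrAC.
Qed.

Section NablaWords.
Variables (k : fieldType) (A : scomalg k) (X : Type) (par : X -> bool) (ldiff : X -> X).
Hypothesis ldiff_par : forall x, par (ldiff x) = ~~ par x.
Notation C := (seq X -> nat -> A).
Notation nabla := (@nabla k A X par ldiff).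

(** nabla preserves the length of words, so bounds that depend only on the length
    pass from F to nabla F. *)
Lemma nabla_closed (K : nat -> (nat -> A) -> Prop) (F : C) s :
    (forall n e u v, K n u -> K n v -> K n (e *: u + v)) -> (forall n, K n 0) ->
    (forall t, K (size t) (F t)) ->
  K (size s) (nabla F s).
Proof.
move=> Klin K0; elim: s K Klin K0 F => [|x s IH] K Klin K0 F hF; first exact: K0.
rewrite /= addrC; apply: (Klin); last exact: (hF (ldiff x :: s)).
apply: (IH (fun n => K n.+1)) => // [n|t]; first exact: Klin.
exact: (hF (x :: t)).
Qed.

Lemma nabla_comp (f : (nat -> A) -> nat -> A) (F : C) s :
  linear f -> nabla (fun t => f (F t)) s = f (nabla F s).
Proof.
move=> fl; elim: s F => [|x s IH] F /=; first by rewrite (lin0 fl).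
by rewrite (linD fl) (linZ fl) -IH.
Qed.

(** For symmetric F the modified letter can be moved to the front. *)
Lemma nabla_split_sum (F : C) s : sym_words par F ->
  nabla F s =
    split_sum par s (fun a b => if a is [:: x] then F (ldiff x :: b) else 0).
Proof.
elim: s F => //= x s IH F Fsym; congr (_ + _).
  by rewrite split_sum_nil_l //= => -[|y a] b.
rewrite IH => [|s1 s2 y z]; last exact: (Fsym (x :: s1)).
rewrite split_sumZ; apply: eq_split_sum => [[|y [|z a]]] b _ _ /=; rewrite ?scaler0 //.
rewrite /dw (Fsym [::] b (ldiff y)) scalerA -signr_addb ldiff_par; congr (_ ^+ _ *: _).
by case: (par x) (par y) => [] [].
Qed.

End NablaWords.

Section Construction.
Variables (k : fieldType) (A : BVinfty k).
Hypotheses (k_char0 : [pchar k] =i pred0) (A_deg : degeneration A).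
Notation X := (bool * A)%type.
Notation par := (@fst bool A).
Notation ps := (nat -> A).
Notation C := (seq X -> nat -> A).
Notation bv_ops := (@bv_ops k A).
Notation Dh := (@Dh k A).
Implicit Types (s : seq X) (x y z : X).

Definition lval x : A := spr A x.1 x.2.
Definition ldiff x : X := (~~ x.1, bvD A 0 x.2).
(** Letters of a common parity whose values, not only whose second components,
    are related by z = e x + y: slot linearity for this relation also says that
    the value at a letter (b, x) depends on the part of x of parity b only. *)
Definition slotR z (e : k) x y :=
  [/\ x.1 = z.1, y.1 = z.1 & lval z = e *: lval x + lval y].

Lemma slotR_par z e x y : slotR z e x y -> par x = par z /\ par y = par z.
Proof. by case. Qed.

Lemma lval_ldiff x : lval (ldiff x) = bvD A 0 (lval x).
Proof.
rewrite /lval /= (@spr_op_parity _ _ true _ (bvD A 0)) //; first exact: linearP.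
by move=> b y; apply: bvD_odd.
Qed.

Notation regular := (@regular k A X par slotR).
Notation nabla := (@nabla k A X par ldiff).
Notation exp_conv := (@exp_conv k A X par).

Definition letter_series : C := fun s => if s is [:: x] then const_series (lval x) else 0.

Lemma regular_letter_series : regular letter_series.
Proof.
have z0 (b : bool) n : homog b ((0 : ps) n) by exact: homog0.
split=> [[|x [|y s]]|[|u [|v s1]] [|w s2] x y|[|u [|v s1]] [|w s2] z e x y Rz] //=;
  rewrite ?scaler0 ?addr0 //.
- by rewrite addbF => -[|n]; [apply: homog_spr|apply: homog0].
- by case: Rz => _ _ ->; rewrite const_series_lin.
Qed.

Lemma nabla_letter_series s :
  nabla letter_series s = serop (coefwise (bvD A 0)) (letter_series s).
Proof.
apply: funext => n; rewrite serop_coefwise.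
case: s => [|x [|y s]] /=; first by rewrite linear0.
  by rewrite addrC scaler0 add0r; case: n => [|n] /=; rewrite ?lval_ldiff ?linear0.
rewrite add0r linear0 -[dw x letter_series _]/(0 : ps) add0r.
have -> : nabla (dw y (dw x letter_series)) s = 0; last by rewrite !scaler0.
have -> : dw y (dw x letter_series) = 0 by [].
by rewrite (lin0 (nabla_lin _ _)).
Qed.

(** Here g is the function described at the beginning. In the proof, E is e^g and
    low is the part of phi E outside the letters; at a word of length n its
    degree is less than n - 1. *)
Lemma exists_linfty_series : exists g : C,
  [/\ g [::] = 0, regular g, forall s, vanish_below (size s).-1 (g s),
      forall x, g [:: x] 0%N = lval x &
      forall s n, s <> [::] ->
        \sum_(r < (size s).+1) (r`!%:R)^-1 *: iter_bracket par g bv_ops r s n (sone A) =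
        nabla g s n].
Proof.
have [psi [psil psie psi0 psiD]] := trivialisation A_deg.
have [phi [phil phiK psiK]] := series_inverse psil psi0.
have Psil := serop_lin psil.
have Psie (b : bool) (u : ps) : phomog b u -> phomog b (serop psi u).
  by move=> hu; apply: (@phomog_serop _ _ false).
have phie (b : bool) (u : ps) : phomog b u -> phomog b (phi u).
  move=> hu n; suff e : (fun n => spr A b (phi u n)) = phi u by rewrite -e; apply: homog_spr.
  apply: (serop_inj psi0); rewrite phiK; apply: funext => m.
  rewrite -[in RHS]hu -[in RHS](phiK u) /serop linear_sum; apply: eq_bigr => i _.
  by rewrite (spr_op_parity _ _ (psil i) (psie i)).
have phi_div m (u : ps) : vanish_below m u -> vanish_below m (phi u).
  move=> hu n; elim/ltn_ind: n => n IH nm.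
  have := congr1 (@^~ n) (phiK u); rewrite hu // /serop big_ord_recl /= psi0 subn0.
  rewrite big1 ?addr0 // => i _; rewrite IH ?(lin0 (psil _)) //.
    by rewrite -subn_gt0 subKn.
  by rewrite (leq_ltn_trans (leq_subr _ _)).
have Dlin : linear (serop (coefwise (bvD A 0))).
  by apply: serop_lin => i; apply: coefwise_lin; apply: linearP.
have phiD u : phi (Dh u) = serop (coefwise (bvD A 0)) (phi u).
  apply: (serop_inj psi0); rewrite phiK -{1}(phiK u) /Dh.
  rewrite !serop_comp //; last exact: bv_ops_lin.
  apply: funext => n; apply: eq_bigr => i _.
  by rewrite sercomp_coefwiser // psiD.
(* the value of phi(e^g) at s becomes the letter plus terms of degree less than
   size s - 1; cutting g makes the right-hand side depend on shorter words only *)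
pose Geq g s := serop psi (letter_series s -
  tail (size s).-1 (phi (exp_higher par (size s) (cut (size s) g) s))) : ps.
have [|g gE] := @measure_fixpoint (seq X) ps 0 size Geq.
  move=> g g' s h; rewrite /Geq; congr (serop psi (_ - tail _ (phi (exp_higher _ _ _ _)))).
  by apply: funext => t; rewrite /cut; case: ifP => // /andP[_ ?]; rewrite h.
have tail_lin m : linear (@tail A m).
  move=> e u v; apply: funext => n.
  rewrite /tail -[RHS]/(e *: (if _ then _ else _) + (if _ then _ else _)).
  by case: ifP; rewrite // scaler0 addr0.
have tail_even m (b : bool) (u : ps) : phomog b u -> phomog b (tail m u).
  by move=> hu n; rewrite /tail; case: ifP => // _; apply: homog0.
have g0 : g [::] = 0.
  rewrite gE /Geq /exp_higher big_ord0 -[(0 : C) _]/(0 : ps) (lin0 phil) (lin0 (tail_lin _)).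
  by rewrite subr0 (lin0 Psil).
have g_div s : vanish_below (size s).-1 (g s).
  rewrite gE; apply: vanish_below_serop => // n ns.
  rewrite -[LHS]/(letter_series s n - tail _ _ n) /tail leqNgt ns subr0.
  by case: s ns => [|x [|y s]].
have step n : regular (cut n g) -> regular (fun s => serop psi (letter_series s -
    tail n.-1 (phi (exp_higher par n (cut n g) s)))).
  move=> hc; apply: (regular_comp Psil Psie).
  rewrite (_ : (fun s => _) =
      (-1) *: (fun s => tail n.-1 (phi (exp_higher par n (cut n g) s))) +
      letter_series); last by apply: funext => s; rewrite addrC -scaleN1r.
  apply: regular_lin; last exact: regular_letter_series.
  apply: (regular_comp (tail_lin n.-1) (@tail_even n.-1)).
  apply: (regular_comp phil phie); apply: regular_sum => i _; apply: regularZ.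
  by apply: regular_iter_conv; first exact: slotR_par.
(* length by length, since the equation for g only involves shorter words *)
have cut_reg n : regular (cut n g).
  elim: n => [|n IH].
    rewrite (_ : cut 0 g = 0); first exact: regular0.
    by apply: funext => s; rewrite /cut ltn0 andbF.
  pose F m : C := if (0 < m < n)%N then cut n g else if (0 < m)%N && (m == n) then
    fun s => serop psi (letter_series s -
      tail n.-1 (phi (exp_higher par n (cut n g) s))) else 0.
  rewrite (_ : cut n.+1 g = fun s => F (size s) s); last first.
    apply: funext => s; rewrite /cut /F ltnS [(size s <= n)%N]leq_eqVlt.
    case: ifP => [/andP[s0 /orP[/eqP sn|sn]]|].
    - by rewrite s0 sn ltnn eqxx /= gE /Geq sn.
    - by rewrite s0 sn /= /cut s0 sn.
    case: (posnP (size s)) => //= _ /negbT.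
    by rewrite negb_or => /andP[/negbTE -> /negbTE ->].
  apply: regular_size => m; rewrite /F; case: ifP => // _.
  case: ifP => // _; last exact: regular0.
  exact: step.
have g_reg : regular g.
  rewrite (_ : g = fun s => cut (size s).+1 g s).
    exact: (regular_size (F := fun m => cut m.+1 g)).
  by apply: funext => -[|x s]; rewrite /cut //= ltnS leqnn.
have [g_even g_sym _] := g_reg.
have g1 x : g [:: x] 0%N = lval x.
  rewrite gE /Geq (_ : exp_higher _ _ _ _ = 0); last first.
    rewrite /exp_higher big_ord1 -[LHS]/(_ *: iter 2 _ _ [:: x]).
    rewrite (@vanish_iter _ _ _ par (cut 1 g) _ 0 2) ?scaler0 //.
  rewrite (lin0 phil) (lin0 (tail_lin _)) subr0 /= /serop big_ord1 /=; exact: psi0.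
exists g; split=> // s0 n0 s0nil.
pose M := (size s0).-1; pose E := exp_conv g M.+2.
have s0_gt0 : (0 < size s0)%N by case: (s0) s0nil.
have sM : (size s0 < M.+2)%N by rewrite /M prednK.
pose P (F : C) : C := tD par bv_ops F - tnabla par ldiff F.
have bl := @bv_ops_lin k A.
have bodd i : op_parity true (bv_ops i) by move=> b x; apply: bvD_odd.
have Plin : linear P.
  by move=> e F G; rewrite /P (tD_lin _ bl) tnabla_lin opprD addrACA scalerBr.
have Ploc n F : vanish n F -> vanish n (P F).
  move=> hF s hs; rewrite -[LHS]/(tD par bv_ops F s - tnabla par ldiff F s).
  by rewrite (vanish_tD par bl hF) // (vanish_tnabla par ldiff hF) // subrr.
have PE s : P E s = (-1) ^+ spar par s *: (Dh (E s) - nabla E s).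
  by rewrite scalerBr.
have exp_adP s n : exp_ad par g P M.+2 s n = (-1) ^+ spar par s *:
   (\sum_(r < M.+2) (r`!%:R)^-1 *: iter_bracket par g bv_ops r s n (sone A) - nabla g s n).
  rewrite scalerBr -(exp_ad_tD bl bodd g_even).
  rewrite (_ : exp_ad par g P M.+2 = exp_ad par g (tD par bv_ops) M.+2 - tnabla par ldiff g) //.
  have ldiff_par x : par (ldiff x) = ~~ par x by [].
  rewrite -(exp_ad_tnabla ldiff_par g_even M) /exp_ad -sumrB; apply: eq_bigr => r _.
  by rewrite -scalerBr iter_adB.
have exp_ad_div s : vanish_below (size s).-1 (exp_ad par g P M.+2 s).
  move=> n hn; rewrite exp_adP big1 => [|r _].
    rewrite sub0r (_ : nabla g s n = 0) ?oppr0 ?scaler0 //.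
    apply: (@nabla_closed _ _ _ _ _ (fun m u => vanish_below m.-1 u)) hn => //.
    by move=> m e u v hu hv i im; rewrite -[LHS]/(e *: u i + v i) hu // hv // scaler0 addr0.
  by rewrite (iter_bracket_vanish_below _ g0) ?scaler0.
pose low : C := fun t => phi (E t) - letter_series t.
have low0 t n : (0 < size t < M.+2)%N -> ((size t).-1 <= n)%N -> low t n = 0.
  case: t => [//|x t] ht hn; rewrite /low /E exp_conv_higher.
  rewrite -[(_ + _) (x :: t)]/(0 + g (x :: t) + exp_higher par M g (x :: t)) add0r.
  rewrite exp_higher_stable // -exp_higher_cut // gE /Geq (linD phil) psiK.
  move: (phi _) (letter_series _) => e l; rewrite /tail.
  rewrite -[LHS]/(l n - (if (_ <= n)%N then e n else 0) + e n - l n) hn.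
  by rewrite subrK subrr.
(* the letters drop out, being compatible with D_0 and nabla *)
have phiPE s : phi (P E s) =
    (-1) ^+ spar par s *: (serop (coefwise (bvD A 0)) (low s) - nabla low s).
  rewrite PE (linZ phil) (linB phil) phiD -(nabla_comp _ _ _ _ phil).
  rewrite (_ : (fun t => phi (E t)) = letter_series + low); last first.
    by apply: funext => t; rewrite -[RHS]/(letter_series t + (_ - letter_series t)) addrC subrK.
  rewrite (linD (nabla_lin _ _)) -[(nabla _ + _) s]/(nabla _ s + nabla _ s) nabla_letter_series.
  rewrite -[phi (E s)](subrK (letter_series s)) -/(low s) (linD Dlin).
  by rewrite [_ + serop _ (letter_series s)]addrC opprD addrACA subrr add0r.
have claim s : (size s < M.+2)%N -> P E s = 0.
  move: {2}(size s).+1 (ltnSn (size s)) => n; elim: n s => // n IH s sn hs.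
  case: (posnP (size s)) => [/size0nil -> |s_gt0].
    rewrite PE (_ : E [::] = const_series (sone A)); last first.
      rewrite /E exp_conv_higher -[LHS]/(const_series _ + g [::] + exp_higher par M g [::]) g0.
      by rewrite exp_higher_stable // /exp_higher big_ord0 !addr0.
    rewrite /= subr0 scale1r; apply: funext => m; rewrite /Dh serop_const_series //.
    exact: bvD_one.
  rewrite -[LHS]phiK (_ : phi _ = 0) ?(lin0 Psil) //; apply: funext => m.
  have [hm|hm] := ltnP m (size s).-1.
    apply: (phi_div (size s).-1) => //.
    rewrite (@exp_ad_leading _ _ _ par k_char0 g g0 P) //.
    move=> t ts; apply: IH; first exact: leq_trans ts _.
    exact: ltn_trans ts hs.
  rewrite phiPE -[LHS]/(_ *: (serop _ (low s) m - nabla low s m)) serop_coefwise.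
  rewrite low0 ?s_gt0 // linear0 (_ : nabla low s m = 0) ?subrr ?scaler0 //.
  apply: (@nabla_closed _ _ _ _ _ (fun l u =>
    (0 < l < M.+2)%N -> forall i, (l.-1 <= i)%N -> u i = 0)) hm => //.
  - move=> l e u v hu hv hl i hi.
    by rewrite -[LHS]/(e *: u i + v i) hu // hv // scaler0 addr0.
  - by move=> t ht i hi; apply: low0.
  - by rewrite s_gt0.
have /(congr1 (@^~ n0)) : exp_ad par g P M.+2 s0 = 0.
  rewrite -(@exp_ad_leading _ _ _ par k_char0 g g0 P) ?claim // => t ts.
  by apply: claim; apply: ltn_trans ts sM.
rewrite exp_adP => /(congr1 (fun v => (-1) ^+ spar par s0 *: v)).
rewrite scalerA -signr_addb addbb scale1r -[(0 : ps) n0]/(0 : A) scaler0.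
by move/eqP; rewrite subr_eq0 => /eqP <-; rewrite /M prednK.
Qed.
End Construction.

(** * Labellings and iterated splittings *)

Section Labellings.
Variables (k : fieldType) (X : Type) (par : X -> bool).
Notation spar := (spar par).
Notation split_sum := (split_sum par).
Implicit Types (s a b : seq X) (x : X) (bl : seq (seq X)) (V W : lmodType k).

Fixpoint cons_block j x bl :=
  match bl, j with
  | [::], _ => [::]
  | b :: bl', 0 => (x :: b) :: bl'
  | b :: bl', j'.+1 => b :: cons_block j' x bl'
  end.

Lemma size_cons_block j x bl : size (cons_block j x bl) = size bl.
Proof. by elim: bl j => [|b bl IH] [|j] //=; rewrite IH. Qed.

Lemma nth_cons_block j x bl l : (j < size bl)%N ->
  nth [::] (cons_block j x bl) l = if l == j then x :: nth [::] bl l else nth [::] bl l.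
Proof.
by elim: bl j l => [|b bl IH] [|j] [|l] //= hj; rewrite IH.
Qed.

Lemma spar_cons_block j x bl : (j < size bl)%N ->
  spar (flatten (cons_block j x bl)) = par x (+) spar (flatten bl).
Proof.
elim: bl j => [|b bl IH] [|j] //= hj; rewrite !spar_cat /= -?addbA // IH //.
by rewrite addbCA.
Qed.

Lemma cons_block_rcons j x bl b : (j < size bl)%N ->
  cons_block j x (rcons bl b) = rcons (cons_block j x bl) b.
Proof. by elim: bl j => [|c bl IH] [|j] //= hj; rewrite IH. Qed.

Lemma cons_block_last x bl b : cons_block (size bl) x (rcons bl b) = rcons bl (x :: b).
Proof. by elim: bl => //= c bl ->. Qed.

(** The analogue of [split_sum] for r blocks, with the Koszul sign of rearranging
    s into the concatenation of the blocks. *)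
Fixpoint block_sum V r s (F : seq (seq X) -> V) : V :=
  if s is x :: s' then
    \sum_(j < r) block_sum r s' (fun bl =>
      (-1) ^+ (par x && spar (flatten (take j bl))) *: F (cons_block j x bl))
  else F (nseq r [::]).

Lemma eq_block_sum V r s (F G : seq (seq X) -> V) :
    (forall bl, size bl = r -> spar (flatten bl) = spar s -> F bl = G bl) ->
  block_sum r s F = block_sum r s G.
Proof.
elim: s F G => [|x s IH] F G h /=.
  by apply: h; rewrite ?size_nseq //; elim: r.
apply: eq_bigr => j _; apply: IH => bl hs hp; rewrite h // ?size_cons_block //.
by rewrite spar_cons_block ?hs // hp.
Qed.

Lemma block_sum_lin V W r s (P : V -> W) F : linear P ->
  P (block_sum r s F) = block_sum r s (fun bl => P (F bl)).
Proof.
move=> Pl; elim: s F => //= x s IH F; rewrite (lin_sum Pl); apply: eq_bigr => j _.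
by rewrite IH; apply: eq_block_sum => bl _ _; rewrite (linZ Pl).
Qed.

Lemma block_sumZ V r s (e : k) (F : seq (seq X) -> V) :
  e *: block_sum r s F = block_sum r s (fun bl => e *: F bl).
Proof.
by apply: (@block_sum_lin V V r s (fun v => e *: v) F) => c u v; rewrite scalerDr !scalerA mulrC.
Qed.

Lemma block_sum_snoc V r s (F : seq (seq X) -> V) :
  block_sum r.+1 s F = split_sum s (fun a b => block_sum r a (fun bl => F (rcons bl b))).
Proof.
elim: s F => [|x s IH] F.
  by rewrite /=; congr F; elim: r => //= r ->.
rewrite /= big_ord_recr; congr (_ + _).
  rewrite split_sum_sum; apply: eq_bigr => j _; rewrite IH.
  apply: eq_split_sum => a b _ _; apply: eq_block_sum => bl hs _.
  have jbl : (j < size bl)%N by rewrite hs.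
  by rewrite cons_block_rcons // -cats1 take_cat jbl.
rewrite IH; apply: eq_split_sum => a b _ _; rewrite block_sumZ.
apply: eq_block_sum => bl hs hp; have takeK : take r (rcons bl b) = bl.
  by rewrite -cats1 -hs take_size_cat.
by rewrite /= takeK hp -{1}hs cons_block_last.
Qed.

Lemma block_sum0 V s (F : seq (seq X) -> V) :
  block_sum 0 s F = if s is [::] then F [::] else 0.
Proof. by case: s => //= x s; rewrite big_ord0. Qed.

Lemma split_sum_as_block_sum V s (F : seq X -> seq X -> V) :
  split_sum s F = block_sum 2 s (fun bl => F (nth [::] bl 0) (nth [::] bl 1)).
Proof.
rewrite block_sum_snoc; apply: eq_split_sum => a b _ _; rewrite block_sum_snoc split_sum_nil_l //.
by move=> [|x a'] b' // _; rewrite block_sum0.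
Qed.

Lemma sign_spar (I : Type) (e : bool) (y : I -> X) (t : seq I) :
  (-1) ^+ (e && spar (map y t)) = \prod_(i <- t) (-1) ^+ (e && par (y i)) :> k.
Proof.
elim: t => [|i t IH]; first by rewrite big_nil andbF.
by rewrite big_cons -IH -signr_addb /= andb_addr.
Qed.

Lemma sub_argsE (T : Type) n (y : 'I_n -> T) (S : {set 'I_n}) :
  sub_args y S = [seq y i | i <- enum 'I_n & i \in S].
Proof. by rewrite /sub_args /image_mem {1}/enum_mem -enumT. Qed.

Lemma koszulE n (p : 'I_n -> bool) (c : 'I_n -> nat) :
  koszul k p c =
  \prod_(i < n) \prod_(j < n) (-1) ^+ [&& (i < j)%N, (c j < c i)%N, p i & p j].
Proof.
rewrite /koszul -prodr_const pair_big big_mkcond; apply: eq_bigr => -[i j] _.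
by rewrite inE /=; case: [&& _, _, _ & _].
Qed.

Definition cons_ffun n r (j : 'I_r) (c : {ffun 'I_n -> 'I_r}) : {ffun 'I_n.+1 -> 'I_r} :=
  [ffun i => if unlift ord0 i is Some i' then c i' else j].

Lemma sum_cons_ffun V n r (F : {ffun 'I_n.+1 -> 'I_r} -> V) :
  \sum_c F c = \sum_(j < r) \sum_c F (cons_ffun j c).
Proof.
rewrite pair_big /= (reindex (fun jc => cons_ffun jc.1 jc.2)) //.
apply: onW_bij.
exists (fun c : {ffun 'I_n.+1 -> 'I_r} => (c ord0, [ffun i : 'I_n => c (lift ord0 i)])).
  case=> j c; congr (_, _); first by rewrite ffunE unlift_none.
  by apply/ffunP => i; rewrite !ffunE liftK.
move=> c.
apply/ffunP => i; rewrite ffunE; case: unliftP => [i' ->|->] //.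
by rewrite ffunE.
Qed.

Definition blocks n r (y : 'I_n -> X) (c : 'I_n -> 'I_r) : seq (seq X) :=
  [seq sub_args y [set i | c i == j] | j : 'I_r].

Lemma size_blocks n r (y : 'I_n -> X) (c : 'I_n -> 'I_r) : size (blocks y c) = r.
Proof. by rewrite size_map size_enum_ord. Qed.

Lemma nth_blocks n r (y : 'I_n -> X) (c : 'I_n -> 'I_r) (j : 'I_r) :
  nth [::] (blocks y c) j = sub_args y [set i | c i == j].
Proof. by rewrite (nth_map j) ?size_enum_ord // nth_ord_enum. Qed.

Lemma sign_blocks n r (e : bool) (y : 'I_n -> X) (c : 'I_n -> 'I_r) j : (j <= r)%N ->
  (-1) ^+ (e && spar (flatten (take j (blocks y c)))) =
  \prod_(i < n) (-1) ^+ [&& (c i < j)%N, e & par (y i)] :> k.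
Proof.
elim: j => [|j IH] hj; first by rewrite take0 andbF big1.
rewrite (take_nth [::]) ?size_blocks // -cats1 flatten_cat spar_cat andb_addr signr_addb.
rewrite IH 1?ltnW //= cats0 -[j in nth _ _ j]/(val (Ordinal hj)) nth_blocks sub_argsE.
rewrite sign_spar big_filter big_enum_cond [X in _ * X]big_mkcond -big_split /=.
apply: eq_bigr => i _; rewrite inE -val_eqE /= ltnS [(c i <= j)%N]leq_eqVlt.
by case: eqP => [->|_]; rewrite ?ltnn /= ?mul1r ?mulr1.
Qed.

(** Induction on n: the sign of the label of the first argument counts the later
    arguments of smaller label, that is, those in the preceding blocks. *)
Lemma sum_labellings V n r (y : 'I_n -> X) (F : seq (seq X) -> V) :
  \sum_(c : {ffun 'I_n -> 'I_r}) koszul k (fun i => par (y i)) (fun i => c i) *: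
      F (blocks y c) = block_sum r [seq y i | i : 'I_n] F.
Proof.
elim: n y F => [|n IH] y F.
  rewrite (big_pred1 (ffun0 (card_ord 0))); last first.
    by move=> c; apply/esym/eqP/ffunP => -[].
  have -> : [seq y i | i : 'I_0] = [::] by rewrite /image_mem enum_ord0.
  rewrite koszulE big_ord0 scale1r /=; congr F.
  apply: (@eq_from_nth _ [::]); rewrite size_blocks ?size_nseq // => j hj.
  rewrite -[j]/(val (Ordinal hj)) nth_blocks sub_argsE enum_ord0 /=.
  by rewrite nth_nseq if_same.
rewrite /image_mem enum_ordSl /= -map_comp sum_cons_ffun; apply: eq_bigr => j _.
rewrite -[map _ (enum _)]/[seq (y \o lift ord0) i | i : 'I_n] -IH.
apply: eq_bigr => c _; rewrite scalerA; congr (_ *: _).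
  rewrite !koszulE big_ord_recl mulrC sign_blocks ?(ltnW (ltn_ord j)) //.
  rewrite big_ord_recl expr0 mul1r; congr (_ * _).
    apply: eq_bigr => i _; rewrite big_ord_recl expr0 mul1r.
    by apply: eq_bigr => l _; rewrite !ffunE !liftK.
  by apply: eq_bigr => i _; rewrite !ffunE liftK unlift_none.
congr F; apply: (@eq_from_nth _ [::]); rewrite size_blocks ?size_cons_block ?size_blocks //.
move=> l hl; rewrite nth_cons_block ?size_blocks // -[l]/(val (Ordinal hl)) !nth_blocks.
rewrite !sub_argsE enum_ordSl /= inE ffunE unlift_none filter_map.
have -> : [seq i <- enum 'I_n |
      preim (lift ord0) (mem [set i0 | cons_ffun j c i0 == Ordinal hl]) i] =
    [seq i <- enum 'I_n | i \in [set i0 | c i0 == Ordinal hl]].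
  by apply: eq_filter => i; rewrite /= !inE ffunE liftK.
have -> : (l == j :> nat) = (j == Ordinal hl) by rewrite eq_sym.
by case: (j == Ordinal hl); rewrite /= -map_comp.
Qed.

Lemma sum_subsets V n (y : 'I_n -> X) (F : seq X -> seq X -> V) :
  \sum_(S : {set 'I_n}) koszul k (fun i => par (y i)) (fun i => i \notin S) *:
     F (sub_args y S) (sub_args y (~: S)) = split_sum [seq y i | i : 'I_n] F.
Proof.
rewrite split_sum_as_block_sum -sum_labellings.
pose h (c : {ffun 'I_n -> 'I_2}) := [set i | c i == ord0].
rewrite (reindex h) /=; last first.
  apply: onW_bij; exists (fun S : {set 'I_n} => [ffun i => inord (i \notin S) : 'I_2]).
    move=> c; apply/ffunP => i; rewrite ffunE inE; apply: val_inj.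
    by rewrite /= inordK; case: (c i) => -[|[|m]].
  move=> S; apply/setP => i; rewrite inE ffunE -val_eqE /= inordK; last by case: (_ \notin _).
  by case: (i \in S).
apply: eq_bigr => c _; congr (_ *: F _ _).
- congr (koszul _ _ _); apply: funext => i; rewrite inE.
  by case: (c i) => -[|[|m]].
- by rewrite -[0%N]/(val (ord0 : 'I_2)) nth_blocks.
- rewrite -[1%N]/(val (ord_max : 'I_2)) nth_blocks; congr (sub_args _ _).
  apply/setP => i; rewrite !inE; by case: (c i) => -[|[|m]].
Qed.

End Labellings.

(** * From homogeneous words to arbitrary sequences *)

Section Words.
Variables (k : fieldType) (A : BVinfty k).
Notation X := (bool * A)%type.
Notation par := (@fst bool A).
Notation slotR := (@slotR k A).
Implicit Types (F : seq X -> A) (s : seq A) (t : seq X).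

(** The multilinear extension to arbitrary arguments of a function given on
    letters with declared parities. *)
Fixpoint par_sum F s : A :=
  if s is x :: s' then \sum_(b : bool) par_sum (fun t => F ((b, x) :: t)) s' else F [::].

(** A letter z of value 0 satisfies z = 1 z + z, so the value of F at the word is
    twice itself. *)
Lemma slot_lin0 F z t1 t2 : slot_lin slotR F -> lval z = 0 -> F (t1 ++ z :: t2) = 0.
Proof.
move=> Fl z0; have := Fl t1 t2 z 1 z z; rewrite scale1r => h.
have /h e : slotR z 1 z z by split; rewrite // z0 scaler0 addr0.
by apply: (addrI (F (t1 ++ z :: t2))); rewrite addr0 -e.
Qed.

Lemma slot_lin_cons F x : slot_lin slotR F -> slot_lin slotR (fun t => F (x :: t)).
Proof. by move=> Fl t1 t2; apply: (Fl (x :: t1)). Qed.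

Lemma eq_par_sum F G s : F =1 G -> par_sum F s = par_sum G s.
Proof.
by elim: s F G => [|x s IH] F G h //=; apply: eq_bigr => b _; apply: IH => t.
Qed.

Lemma par_sum_lin (e : k) F G s :
  par_sum (fun t => e *: F t + G t) s = e *: par_sum F s + par_sum G s.
Proof.
elim: s F G => //= x s IH F G; rewrite scaler_sumr -big_split; apply: eq_bigr => b _.
by rewrite IH.
Qed.

Lemma par_sum0 s : par_sum (fun=> 0) s = 0.
Proof. by elim: s => //= x s IH; rewrite big1. Qed.

Lemma par_sumZ (e : k) F s : par_sum (fun t => e *: F t) s = e *: par_sum F s.
Proof.
rewrite -[RHS]addr0 -(par_sum0 s) -par_sum_lin; apply: eq_par_sum => t.
by rewrite addr0.
Qed.

Lemma lval_homog b (c : bool) (x : A) : homog b x -> lval (c, x) = if c == b then x else 0.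
Proof. exact: spr_homog. Qed.

Lemma par_sum_homog F b x s : slot_lin slotR F -> homog b x ->
  par_sum F (x :: s) = par_sum (fun t => F ((b, x) :: t)) s.
Proof.
move=> Fl hx; rewrite /= (bigD1 b) //= big1 ?addr0 // => c cb.
rewrite -[RHS](par_sum0 s); apply: eq_par_sum => t.
by apply: (slot_lin0 [::]) => //; rewrite (lval_homog _ hx) (negbTE cb).
Qed.

Lemma par_sum_map F t : slot_lin slotR F -> (forall z, List.In z t -> homog z.1 z.2) ->
  par_sum F (map snd t) = F t.
Proof.
elim: t F => //= -[b x] t IH F Fl ht.
rewrite -[LHS]/(par_sum F (x :: map snd t)) (par_sum_homog _ Fl (ht _ (or_introl erefl))).
by rewrite IH // => [|z hz]; [apply: slot_lin_cons|apply: ht; right].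
Qed.

Lemma par_sum_multilinear F (s1 s2 : seq A) (c : k) (x y : A) : slot_lin slotR F ->
  par_sum F (s1 ++ (c *: x + y) :: s2) =
    c *: par_sum F (s1 ++ x :: s2) + par_sum F (s1 ++ y :: s2).
Proof.
elim: s1 F => [|z s1 IH] F Fl /=; rewrite scaler_sumr -big_split; apply: eq_bigr => b _ /=.
  rewrite -par_sum_lin; apply: eq_par_sum => t; apply: (Fl [::]); split=> //.
  by rewrite /lval linearP.
by apply: IH; apply: slot_lin_cons.
Qed.

Lemma par_sum_symmetric F (s1 s2 : seq A) (b c : bool) (x y : A) :
    slot_lin slotR F -> sym_words par F -> homog b x -> homog c y ->
  par_sum F (s1 ++ x :: y :: s2) =
    (-1) ^+ (b && c) *: par_sum F (s1 ++ y :: x :: s2).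
Proof.
move=> Fl Fs hx hy; elim: s1 F Fl Fs => [|z s1 IH] F Fl Fs; last first.
  rewrite /= scaler_sumr; apply: eq_bigr => d _; apply: IH.
    exact: slot_lin_cons.
  by move=> t1 t2 u v; apply: (Fs (_ :: t1)).
rewrite !cat0s (par_sum_homog _ Fl hx) (par_sum_homog _ Fl hy).
rewrite (par_sum_homog _ (slot_lin_cons _ Fl) hx) (par_sum_homog _ (slot_lin_cons _ Fl) hy).
by rewrite -par_sumZ; apply: eq_par_sum => t; apply: (Fs [::]).
Qed.

End Words.

Section Main.
Variables (k : fieldType) (A : BVinfty k).
Notation V := (Pi (Pi A)).

Lemma homogPP b (x : A) : homog (V := V) b x <-> homog (V := A) b x.
Proof. by case: b. Qed.

(** The operations of the abelian model. *)
Definition lin_op (s : seq V) : V := if s is [:: a] then bvD A 0 a else 0.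

Lemma lin_op_multimap : multimap true lin_op.
Proof.
split=> //.
- move=> [|u [|v s1]] [|w s2] c x y //=; rewrite ?scaler0 ?addr0 //; exact: linearP.
- by move=> [|u [|v s1]] s2 b c x y _ _ /=; rewrite scaler0.
- move=> [|[|n]] p x hx; rewrite /image_mem.
  + by rewrite enum_ord0; apply: homog0.
  + rewrite enum_ordSl enum_ord0 big_ord_recl big_ord0 addbF /=.
    by apply/homogPP; apply: bvD_odd; apply/homogPP.
  + by rewrite !enum_ordSl; apply: homog0.
Qed.

Lemma lin_op_structure : Linfty_structure (V := Pi A) lin_op.
Proof.
split=> [|n p x _]; first exact: lin_op_multimap.
apply: big1 => S _; rewrite -[RHS](scaler0 _ (koszul k p (fun i => i \notin S))).
congr (_ *: _); rewrite /lin_op; case: (sub_args x (~: S)) => // .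
case: (sub_args x S) => [|u [|v s]]; rewrite ?linear0 //.
by have := bvD_sq 0 u; rewrite big_ord1.
Qed.

(** The second term of the commutator [D_0, v] vanishes at 1, as D_0(1) = 0. *)
Lemma bv_op1 (v : V) : bv_op [:: v] = bvD A 0 v.
Proof.
have Dl : linear (bvD A 0) by apply: linearP.
rewrite -[bvD A 0 v]/(bvD A 0 (v : A)) -[in RHS](sum_spr (V := A) v) (lin_sum Dl).
rewrite -[LHS]/(scomm (bvD A 0) (smul (v : A)) (sone A)).
have -> : scomm (bvD A 0) (smul (v : A)) =
    \sum_(b : bool) scomm (bvD A 0) (smul (spr A b v)).
  rewrite big_bool /= -{1}[v](sum_spr (V := A)) big_bool /=.
  by rewrite -[spr A true v]scale1r scomm_linr // !scale1r.
rewrite sum_fctE; apply: eq_bigr => b _.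
rewrite (scommE (c := true) (b := b)) //; last exact: homog_spr.
  by rewrite smulx1 bvD_one (lin0 (smul_lin_r _)) scaler0 subr0.
by move=> c x; apply: bvD_odd.
Qed.

End Main.

(** * The quasi-isomorphism *)

Section Morphism.
Variables (k : fieldType) (A : BVinfty k).
Notation V := (Pi (Pi A)).
Notation X := (bool * A)%type.
Notation par := (@fst bool A).
Variable g : seq X -> nat -> A.
Hypotheses (g0 : g [::] = 0) (g_reg : regular par (@slotR k A) g).
Hypothesis g_div : forall s, vanish_below (size s).-1 (g s).
Hypothesis g1 : forall x, g [:: x] 0%N = lval x.
Hypothesis gE : forall s n, s <> [::] ->
  \sum_(r < (size s).+1) (r`!%:R)^-1 *: iter_bracket par g (@bv_ops k A) r s n (sone A) =
  nabla par (@ldiff k A) g s n.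

Definition morphism (s : seq V) : V := par_sum (lead_val g) (s : seq A).

Lemma lead_val_slot : slot_lin (@slotR k A) (lead_val g).
Proof.
have [_ _ h] := g_reg; move=> s1 s2 z e x y Rz.
rewrite /lead_val (h _ _ _ _ _ _ Rz) (size_slot _ _ z x) (size_slot _ _ y x).
by [].
Qed.

Lemma lead_val_sym : sym_words par (lead_val g).
Proof.
have [_ h _] := g_reg; move=> s1 s2 x y; rewrite /lead_val h.
by rewrite !size_cat.
Qed.

Lemma lead_val_even s : homog (spar par s) (lead_val g s).
Proof. by have [h _ _] := g_reg; apply: h. Qed.

Section Args.
Variables (n : nat) (p : 'I_n -> bool) (x : 'I_n -> V).
Hypothesis hx : forall i, homog (p i) (x i).
Let y (i : 'I_n) : X := (p i, x i : A).

Lemma sub_args_snd (S : {set 'I_n}) : sub_args x S = map snd (sub_args y S).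
Proof. by rewrite /sub_args /image_mem -map_comp. Qed.

Lemma In_homog (S : seq 'I_n) z : List.In z (map y S) -> homog z.1 z.2.
Proof.
by elim: S => //= i S IH [<-|/IH //]; apply/homogPP; apply: hx.
Qed.

Lemma morphism_sub_args (S : {set 'I_n}) :
  morphism (sub_args x S) = lead_val g (sub_args y S).
Proof.
rewrite sub_args_snd /morphism par_sum_map //; first exact: lead_val_slot.
by move=> z; apply: In_homog.
Qed.

(** As lin_op vanishes unless it has a single argument, only the subsets with one
    element contribute. *)
Lemma comp_coder_lin_op :
  comp_coder morphism (lin_op (A := A)) p x =
  split_sum par [seq y i | i : 'I_n]
    (fun a b => if a is [:: z] then lead_val g (ldiff z :: b) else 0).
Proof.
rewrite -sum_subsets; apply: eq_bigr => S _; congr (_ *: _).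
rewrite !sub_args_snd.
have h (T : {set 'I_n}) z : List.In z (sub_args y T) -> homog z.1 z.2 by apply: In_homog.
move: (sub_args y S) (sub_args y (~: S)) (h S) (h (~: S)) => a b ha hb.
have z0 : morphism ((0 : V) :: map snd b) = 0.
  have := @par_sum_multilinear k A (lead_val g) [::] (map snd b) (-1) 0 0 lead_val_slot.
  by rewrite /= scaler0 addr0 scaleN1r addNr.
case: a ha => [|[c u] [|v a]] ha; rewrite /lin_op /= ?z0 //.
rewrite -[LHS]/(par_sum (lead_val g) (map snd ((~~ c, bvD A 0 u) :: b))).
rewrite par_sum_map //; first exact: lead_val_slot.
move=> z [<-|/hb //]; apply: bvD_odd; exact: (ha (c, u) (or_introl erefl)).
Qed.

Lemma comp_comor_bv_op :
  comp_comor (bv_op (A := A)) morphism p x =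
  \sum_(r < n.+1) (r`!%:R)^-1 *:
     block_sum par r [seq y i | i : 'I_n]
       (fun bl => bv_op (A := A) (map (lead_val g) bl)).
Proof.
apply: eq_bigr => r _; congr (_ *: _); rewrite -sum_labellings.
apply: eq_bigr => c _; congr (_ *: bv_op _).
rewrite /blocks /image_mem -map_comp; apply: eq_map => j /=.
exact: morphism_sub_args.
Qed.

End Args.

Lemma block_sum_bv_op r s :
  block_sum par r.+1 s (fun bl => bv_op (A := A) (map (lead_val g) bl)) =
  lead_bracket par g r r.+1 s (sone A).
Proof.
have -> : lead_bracket par g r r.+1 s = block_sum par r.+1 s
    (fun bl => foldl (fun P a => scomm P (smul a)) (@bv_ops k A r) (map (lead_val g) bl)).
  move: (r.+1) => m; elim: m s => [|m IH] s; first by rewrite block_sum0.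
  rewrite block_sum_snoc /=; apply: eq_split_sum => a b _ _; rewrite IH.
  rewrite (block_sum_lin _ _ _ (P := fun Q => scomm Q (smul (lead_val g b)))).
    by apply: eq_block_sum => bl _ _; rewrite map_rcons foldl_rcons.
  by move=> e P1 P2; apply: scomm_linl; apply: smul_lin_r.
rewrite (block_sum_lin _ _ _ (P := fun Q : A -> A => Q (sone A))) //.
apply: eq_block_sum => -[|b bl] //= [sbl] _.
by rewrite /bv_op /= size_map sbl.
Qed.

(** The coefficient of h^(n-1) in the equation satisfied by g. *)
Lemma morphism_equation n (p : 'I_n -> bool) (x : 'I_n -> V) :
    (forall i, homog (p i) (x i)) ->
  comp_coder morphism (lin_op (A := A)) p x =
  comp_comor (bv_op (A := A)) morphism p x.
Proof.
move=> hx; rewrite comp_coder_lin_op // comp_comor_bv_op //.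
set s := [seq _ | i : 'I_n].
have ss : size s = n by rewrite size_map size_enum_ord.
have [s0|s0] := pselect (s = [::]).
  have n0 : n = 0%N by rewrite -ss s0.
  by rewrite s0 -ss s0 big_ord1 /= scaler0.
have [_ gsym _] := g_reg.
transitivity (nabla par (@ldiff k A) g s (size s).-1).
  rewrite (nabla_split_sum _ _ gsym) //.
  rewrite (split_sum_lin par s (P := fun u : nat -> A => u (size s).-1)) //.
  by apply: eq_split_sum => -[|z [|w a]] b hab _ //; rewrite /lead_val -hab.
rewrite -gE // ss big_ord_recl [RHS]big_ord_recl; congr (_ + _).
  by rewrite block_sum0; case: (s) s0 => // z t _; rewrite /= !scaler0.
have e : n.-1 = (size s).-1 by rewrite ss.
by apply: eq_bigr => r _; rewrite block_sum_bv_op e -(iter_bracket_top par g0).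
Qed.

Lemma morphism_qiso :
  Linfty_qiso (V := Pi A) (W := Pi A) (lin_op (A := A)) (bv_op (A := A)) morphism.
Proof.
have f1 (v : V) : morphism [:: v] = v.
  rewrite /morphism /= /lead_val /=.
  by under eq_bigr => b _ do rewrite g1 /lval /=; rewrite sum_spr.
split; last 2 first.
- by move=> v _ [w]; rewrite f1 bv_op1 => ->; exists w.
- move=> w; rewrite bv_op1 => w0; exists w => //.
  by exists 0; rewrite f1 bv_op1 linear0 subrr.
split=> [|n p x hx]; last exact: morphism_equation.
split.
- move=> s1 s2 c x y; apply: par_sum_multilinear; exact: lead_val_slot.
- move=> s1 s2 b c x y hx hy; apply: par_sum_symmetric; [exact: lead_val_slot|
    exact: lead_val_sym | exact/homogPP | exact/homogPP].
- move=> n p x hx; apply/homogPP.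
  have -> : [seq x i | i : 'I_n] = sub_args x [set: 'I_n].
    by rewrite /sub_args; apply: eq_image => // i; rewrite finset.in_setT.
  rewrite (morphism_sub_args hx).
  have := lead_val_even (sub_args (fun i => (p i, x i : A)) [set: 'I_n]).
  congr (homog _ _); rewrite addFb sub_argsE.
  rewrite (eq_filter (a2 := xpredT)) => [|i]; last by rewrite inE.
  rewrite filter_predT -big_enum; elim: (enum 'I_n) => [|i l IH] /=.
    by rewrite big_nil.
  by rewrite big_cons IH.
- by rewrite /morphism /= /lead_val g0.
Qed.

End Morphism.

Theorem theorem3p18 (k : fieldType) (k_char0 : [pchar k] =i pred0)
    (A : BVinfty k) (A_deg : degeneration A) :
  homotopy_abelian (V := Pi A) (bv_op (A := A)).
Proof.
have [g [g0 g_reg g_div g1 gE]] := exists_linfty_series k_char0 A_deg.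
exists (Pi A), (lin_op (A := A)); split.
- exact: lin_op_structure.
- by move=> [|x [|y s]].
- by right; exists (morphism g); apply: morphism_qiso.
Qed.
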